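(* Let $\Lambda\subset(0,\infty)$ be finite or countable and let $\rho$ be a unitary representation of the group $\mathbb{I}_\Lambda$ in a Hilbert space $H$. For nonempty finite subsets $X,Y\subset\mathbb{U}_\Lambda$ let $\widehat\rho_{X,Y}(\mathfrak p):H[X]\to H[Y]$, $\mathfrak p\in\mathrm{Mor}(X,Y)$, be the operators defined in the context. Then: a) The maps $\mathfrak p\mapsto\widehat\rho_{X,Y}(\mathfrak p)$ determine a representation of the category $\mathcal K_\Lambda$ (a functor to the category of Hilbert spaces and bounded linear operators): for any nonempty finite $X,Y,Z\subset\mathbb U_\Lambda$ and any $\mathfrak p\in\mathrm{Mor}(X,Y)$, $\mathfrak q\in\mathrm{Mor}(Y,Z)$, $$\widehat\rho_{Y,Z}(\mathfrak q)\,\widehat\rho_{X,Y}(\mathfrak p)=\widehat\rho_{X,Z}(\mathfrak q\diamond\mathfrak p).$$ b) $\|\widehat\rho_{X,Y}(\mathfrak p)\|\le 1$ for all $\mathfrak p\in\mathrm{Mor}(X,Y)$. c) For all nonempty finite $X,Y\subset\mathbb U_\Lambda$ and all $\mathfrak p\in\mathrm{Mor}(X,Y)$, $\widehat\rho_{X,Y}(\mathfrak p)^*=\widehat\rho_{Y,X}(\mathfrak p^* )$. d) Each map $\widehat\rho_{X,Y}$ is continuous as a map from the double coset space $\mathbb I[Y]\backslash\mathbb I_\Lambda/\mathbb I[X]$, equipped with the quotient topology, to the space of bounded operators $H[X]\to H[Y]$ equipped with the weak operator topology. e) For all $X$, $\widehat\rho_{X,X}(1_X)=1_{H[X]}$.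
   Context: An ultrametric space is a metric space with $d(x,z)\le\max(d(x,y),d(y,z))$; its spectrum is its set of nonzero distances. $\mathbb U_\Lambda$ is the ultrametric Urysohn space: the unique (up to isometry) complete separable ultrametric space with spectrum $\Lambda$ such that for any finite ultrametric spaces $X\subset Y$ with spectra in $\Lambda$, each isometric embedding $X\to\mathbb U_\Lambda$ extends to an isometric embedding $Y\to\mathbb U_\Lambda$. (Model: functions $\omega:\Lambda\to\mathbb Z$ whose support is finite or a sequence converging to $0$, with $d(\omega,\omega')=\max\{\lambda:\omega(\lambda)\ne\omega'(\lambda)\}$ for $\omega\neq\omega'$.) $\mathbb I_\Lambda$ is the group of all bijective isometries of $\mathbb U_\Lambda$, acting on the left, with the topology of pointwise convergence (a Polish group). Unitary representations are continuous homomorphisms to the unitary group (strong operator topology) of a separable Hilbert space. Category $\mathcal K_\Lambda$: objects are nonempty finite ultrametric spaces with spectrum contained in $\Lambda$. A morphism $\mathfrak p:X\to Y$ is a triple $(P,p_+,p_-)$, where $P$ is an ultrametric space with spectrum in $\Lambda$, and $p_+:X\to P$, $p_-:Y\to P$ are isometric embeddings with $p_+(X)\cup p_-(Y)=P$; two triples $(P,p_\pm)$, $(P',p'_\pm)$ are equal if there is an isometry $\pi:P\to P'$ with $p'_\pm=\pi\circ p_\pm$. Product of $\mathfrak p=(P,p_+,p_-):X\to Y$ and $\mathfrak q=(Q,q_+,q_-):Y\to Z$: glue $P\sqcup Q$ by identifying $p_-(y)\sim q_+(y)$ for all $y\in Y$; on the resulting set $P\Join Q$ keep the metrics of $P$ and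 $Q$, and for $a\in P\setminus p_-(Y)$, $b\in Q\setminus q_+(Y)$ put $d(a,b)=\min_{y\in Y}\max(d_P(a,p_-(y)),d_Q(q_+(y),b))$ (this is an ultrametric). Then $\mathfrak q\diamond\mathfrak p:X\to Z$ is $(R,p_+,q_-)$ with $R=p_+(X)\cup q_-(Z)\subset P\Join Q$. Involution: $(P,p_+,p_-)^*=(P,p_-,p_+):Y\to X$. Unit: $1_X=(X,\mathrm{id},\mathrm{id})$. For finite $X\subset\mathbb U_\Lambda$, $\mathbb I[X]\subset\mathbb I_\Lambda$ is the pointwise stabilizer of $X$. To $g\in\mathbb I_\Lambda$ and finite $X,Y\subset\mathbb U_\Lambda$ one assigns the morphism $X\to Y$ given by $P=Y\cup g(X)$, $p_+=g|_X$, $p_-=$ inclusion of $Y$; this induces a bijection $\mathbb I[Y]\backslash\mathbb I_\Lambda/\mathbb I[X]\simeq\mathrm{Mor}(X,Y)$. $H[X]\subset H$ is the subspace of $\mathbb I[X]$-fixed vectors, $\Pi[X]$ is the orthogonal projection onto $H[X]$, and $\widehat\rho_{X,Y}(g):=\Pi[Y]\rho(g)|_{H[X]}:H[X]\to H[Y]$; it depends only on the double coset $\mathbb I[Y]\,g\,\mathbb I[X]$, hence is a function $\widehat\rho_{X,Y}(\mathfrak p)$ of $\mathfrak p\in\mathrm{Mor}(X,Y)$. *)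

(* Defs.v *)
From HB Require Import structures.
From mathcomp Require Import all_boot all_order all_algebra.
From mathcomp Require Import finmap complex.
From mathcomp Require Import all_classical all_reals all_analysis.
From mathcomp Require Import ring.

Set Implicit Arguments.
Unset Strict Implicit.
Unset Printing Implicit Defensive.

Import Order.TTheory GRing.Theory Num.Theory.
Import numFieldNormedType.Exports.

Local Open Scope classical_set_scope.
Local Open Scope ring_scope.

Definition separable (T : topologicalType) : Prop :=
  exists2 D : set T, countable D & dense D.

Section Ultrametric.
Context {R : realType}.

Definition ultrametric (T : Type) (d : T -> T -> R) : Prop :=
  [/\ forall x y, d x y = 0 <-> x = y,
      forall x y, d x y = d y x &
      forall x y z, d x z <= Num.max (d x y) (d y z)].

Definition spectrum (T : Type) (d : T -> T -> R) : set R :=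
  [set r | r != 0 /\ exists x y, d x y = r].

Definition isometric (S T : Type) (dS : S -> S -> R) (dT : T -> T -> R)
  (f : S -> T) : Prop := forall x y, dT (f x) (f y) = dS x y.

Lemma ultrametric_ge0 (T : Type) (d : T -> T -> R) :
  ultrametric d -> forall x y, 0 <= d x y.
Proof.
move=> [d0 dC dM] x y; have <- : d x x = 0 by apply/d0.
by rewrite (le_trans (dM x y x))// dC maxxx.
Qed.

Lemma isometric_inj (S T : Type) (dS : S -> S -> R) (dT : T -> T -> R) f :
  ultrametric dS -> ultrametric dT -> isometric dS dT f -> injective f.
Proof.
move=> [dS0 _ _] [dT0 _ _] fE x y fxy.
by apply/dS0; rewrite -fE; apply/dT0.
Qed.

Lemma ultrametric_pull (S T : Type) (dT : T -> T -> R) (f : S -> T) :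
  injective f -> ultrametric dT -> ultrametric (fun x y => dT (f x) (f y)).
Proof.
move=> fI [d0 dC dM]; split=> [x y|x y|x y z]; [|exact: dC|exact: dM].
by split=> [/d0/fI|->]; last exact/d0.
Qed.

Lemma spectrum_pull (S T : Type) (dT : T -> T -> R) (f : S -> T) :
  spectrum (fun x y => dT (f x) (f y)) `<=` spectrum dT.
Proof. by move=> r [r0 [x [y xy]]]; split=> //; exists (f x), (f y). Qed.

Record finUltra (Lam : set R) := FinUltra {
  fu_sort :> finType;
  fdist : fu_sort -> fu_sort -> R;
  fu_ultra : ultrametric fdist;
  fu_spec : spectrum fdist `<=` Lam }.

Record urysohn (Lam : set R) := Urysohn {
  ury_sort :> metricType R;
  ury_ultra : ultrametric (@mdist R ury_sort);
  ury_complete : forall F : set_system ury_sort,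
    ProperFilter F -> cauchy F -> exists l : ury_sort, F --> l;
  ury_separable : separable ury_sort;
  ury_spec : spectrum (@mdist R ury_sort) = Lam;
  (* X may be empty, hence U is nonempty even when Lam is empty. *)
  ury_ext : forall (X Y : finUltra Lam) (i : X -> Y) (f : X -> ury_sort),
    isometric (@fdist _ X) (@fdist _ Y) i ->
    isometric (@fdist _ X) (@mdist R ury_sort) f ->
    exists2 h : Y -> ury_sort,
      isometric (@fdist _ Y) (@mdist R ury_sort) h & h \o i =1 f }.

End Ultrametric.

Section Category.
Context {R : realType} {Lam : set R}.

Record kobj := KObj {
  kobj_space :> finUltra Lam;
  kobj_ne : (0 < #|kobj_space|)%N }.

Definition kpoint (X : kobj) : X := enum_val (Ordinal (kobj_ne X)).

(* A representative (P, p_+, p_-) of a morphism X -> Y. Equality of morphisms is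
   the equivalence mor_eqv below, which product and involution respect
   (mor_comp_eqv, mor_inv_eqv). The carrier P is automatically finite, being
   the union of two finite sets. *)
Record mor (X Y : kobj) := Mor {
  mor_space :> finUltra Lam;
  mplus : X -> mor_space;
  mminus : Y -> mor_space;
  mplus_iso : isometric (@fdist _ _ X) (@fdist _ _ mor_space) mplus;
  mminus_iso : isometric (@fdist _ _ Y) (@fdist _ _ mor_space) mminus;
  mor_cover : forall a : mor_space,
    (exists x, a = mplus x) \/ (exists y, a = mminus y) }.

Definition mor_eqv (X Y : kobj) (p p' : mor X Y) : Prop :=
  exists pi : p -> p',
    [/\ bijective pi, isometric (@fdist _ _ p) (@fdist _ _ p') pi,
        forall x, pi (mplus p x) = mplus p' x &
        forall y, pi (mminus p y) = mminus p' y].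

Lemma mor_eqvP (X Y : kobj) (p p' : mor X Y) :
  mor_eqv p p' <-> forall x y,
    fdist (mplus p x) (mminus p y) = fdist (mplus p' x) (mminus p' y).
Proof.
split=> [[pi [_ piE pip pim]] x y|pp']; first by rewrite -piE pip pim.
have [d0 dC _] := @fu_ultra _ _ p; have [d0' dC' _] := @fu_ultra _ _ p'.
pose rel (q q' : mor X Y) (a : q) (b : q') :=
  (exists2 x, a = mplus q x & b = mplus q' x) \/
  (exists2 y, a = mminus q y & b = mminus q' y).
have relP (q q' : mor X Y) (a : q) : exists b : q', rel q q' a b.
  have [[x ->]|[y ->]] := mor_cover a.
    by exists (mplus q' x); left; exists x.
  by exists (mminus q' y); right; exists y.
have relC (q q' : mor X Y) a b : rel q q' a b -> rel q' q b a.
  by move=> [[x]|[y]]; [left; exists x|right; exists y].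
have reld a a' b b' : rel p p' a b -> rel p p' a' b' -> fdist b b' = fdist a a'.
  move=> [[x -> ->]|[y -> ->]] [[x' -> ->]|[y' -> ->]].
  - by rewrite !mplus_iso.
  - by rewrite pp'.
  - by rewrite dC dC' pp'.
  - by rewrite !mminus_iso.
have relf a b b' : rel p p' a b -> rel p p' a b' -> b = b'.
  by move=> r1 r2; apply/d0'; rewrite (reld _ _ _ _ r1 r2); apply/d0.
have relf' a a' b : rel p p' a b -> rel p p' a' b -> a = a'.
  by move=> r1 r2; apply/d0; rewrite -(reld _ _ _ _ r1 r2); apply/d0'.
pose f a := projT1 (cid (relP p p' a)).
have fP a : rel p p' a (f a) by exact: projT2 (cid (relP p p' a)).
pose g b := projT1 (cid (relP p' p b)).
have gP b : rel p p' (g b) b by apply/relC; exact: projT2 (cid (relP p' p b)).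
exists f; split.
- by exists g => [a|b]; [apply: relf' (gP _) (fP _)|apply: relf (fP _) (gP _)].
- by move=> a a'; exact: reld.
- by move=> x; apply: relf (fP _) _; left; exists x.
- by move=> y; apply: relf (fP _) _; right; exists y.
Qed.

Lemma mor_eqv_refl (X Y : kobj) (p : mor X Y) : mor_eqv p p.
Proof. exact/mor_eqvP. Qed.

Lemma mor_eqv_sym (X Y : kobj) (p q : mor X Y) : mor_eqv p q -> mor_eqv q p.
Proof. by move=> /mor_eqvP pq; apply/mor_eqvP => x y; rewrite pq. Qed.

Lemma mor_eqv_trans (X Y : kobj) (p q r : mor X Y) :
  mor_eqv p q -> mor_eqv q r -> mor_eqv p r.
Proof.
by move=> /mor_eqvP pq /mor_eqvP qr; apply/mor_eqvP => x y; rewrite pq qr.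
Qed.

Lemma mor_id_cover (X : kobj) (a : X) :
  (exists x, a = idfun x) \/ (exists y, a = idfun y).
Proof. by left; exists a. Qed.

Definition mor_id (X : kobj) : mor X X :=
  @Mor X X X idfun idfun (fun _ _ => erefl) (fun _ _ => erefl)
    (@mor_id_cover X).

Lemma mor_inv_cover (X Y : kobj) (p : mor X Y) (a : p) :
  (exists y, a = mminus p y) \/ (exists x, a = mplus p x).
Proof. by rewrite or_comm; exact: mor_cover. Qed.

Definition mor_inv (X Y : kobj) (p : mor X Y) : mor Y X :=
  @Mor Y X p (mminus p) (mplus p) (@mminus_iso _ _ p) (@mplus_iso _ _ p)
    (@mor_inv_cover _ _ p).

Section Glue.
Context {X Y Z : kobj} (q : mor Y Z) (p : mor X Y).

(* The gluing of P and Q along p_-(y) ~ q_+(y), encoded as the disjoint union of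
   P and Q \ q_+(Y); glueP and glueQ are the maps from P and Q to it. *)
Definition glue : finType := (p + {b : q | b \notin codom (mplus q)})%type.

(* For a = p_-(y) (resp. b = q_+(y)) the minimum is the distance in Q
   (resp. in P): see cross_dist_Q and cross_dist_P. *)
Definition cross_dist (a : p) (b : q) : R :=
  let D y := Num.max (fdist a (mminus p y)) (fdist (mplus q y) b) in
  \big[Num.min/D (kpoint Y)]_(y : Y) D y.

Definition glue_dist (u v : glue) : R :=
  match u, v with
  | inl a, inl a' => fdist a a'
  | inl a, inr b => cross_dist a (val b)
  | inr b, inl a => cross_dist a (val b)
  | inr b, inr b' => fdist (val b) (val b')
  end.

Definition glueP (a : p) : glue := inl a.

(* The last branch is never reached: see glueQP. *)
Definition glueQ (b : q) : glue :=
  if [pick y | mplus q y == b] is Some y then inl (mminus p y)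
  else if insub b is Some b' then inr b' else inl (mminus p (kpoint Y)).

Let D a b y := Num.max (fdist a (mminus p y)) (fdist (mplus q y) b).

Lemma cross_dist_le a b y : cross_dist a b <= D a b y.
Proof. exact: bigmin_le_cond. Qed.

Lemma cross_dist_ex a b : exists y, cross_dist a b = D a b y.
Proof.
rewrite /cross_dist.
elim/big_ind: _ => [|u v [y ->] [y' ->]|y _]; [by exists (kpoint Y)| |by exists y].
by case: leP => _; [exists y|exists y'].
Qed.

Let dp : ultrametric (@fdist _ _ p) := @fu_ultra _ _ p.
Let dq : ultrametric (@fdist _ _ q) := @fu_ultra _ _ q.

Let dYpq y y' : fdist (mminus p y) (mminus p y') = fdist (mplus q y) (mplus q y').
Proof. by rewrite mminus_iso mplus_iso. Qed.

Lemma cross_dist_Q y b : cross_dist (mminus p y) b = fdist (mplus q y) b.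
Proof.
have [p0 pC pM] := dp; have [q0 qC qM] := dq.
apply/eqP; rewrite eq_le; apply/andP; split.
  rewrite (le_trans (cross_dist_le _ _ y))// /D.
  by rewrite (p0 _ _).2// ge_max lexx ultrametric_ge0.
by have [y' ->] := cross_dist_ex (mminus p y) b; rewrite /D dYpq.
Qed.

Lemma cross_dist_P a y : cross_dist a (mplus q y) = fdist a (mminus p y).
Proof.
have [p0 pC pM] := dp; have [q0 qC qM] := dq.
apply/eqP; rewrite eq_le; apply/andP; split.
  rewrite (le_trans (cross_dist_le _ _ y))// /D.
  by rewrite ((q0 _ _).2 erefl) ge_max lexx ultrametric_ge0.
by have [y' ->] := cross_dist_ex a (mplus q y); rewrite /D -dYpq.
Qed.

Lemma glueQ_plus y : glueQ (mplus q y) = glueP (mminus p y).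
Proof.
rewrite /glueQ; case: pickP => [y' /eqP yy'|/(_ y)]; last by rewrite eqxx.
by congr (inl (mminus p _)); exact: isometric_inj (fu_ultra _) dq (mplus_iso q) _ _ yy'.
Qed.

Lemma glueQP (b : q) :
  (exists2 y, b = mplus q y & glueQ b = inl (mminus p y)) \/
  (exists2 b', b = val b' & glueQ b = inr b').
Proof.
have [/codomP[y ->]|bq] := boolP (b \in codom (mplus q)).
  by left; exists y => //; rewrite glueQ_plus.
right; exists (Sub b bq) => //; rewrite /glueQ.
case: pickP => [y /eqP yb|_]; first by case/negP: (bq); rewrite -yb codom_f.
by rewrite insubT.
Qed.

Lemma glueP_iso : isometric (@fdist _ _ p) glue_dist glueP.
Proof. by []. Qed.

Lemma glueQ_iso : isometric (@fdist _ _ q) glue_dist glueQ.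
Proof.
have [q0 qC qM] := dq.
move=> b b'; have [[y -> ->]|[c -> ->]] := glueQP b;
  have [[y' -> ->]|[c' -> ->]] := glueQP b' => //=.
- by rewrite cross_dist_Q.
- by rewrite cross_dist_Q qC.
Qed.

Lemma glueP_Q a b : glue_dist (glueP a) (glueQ b) = cross_dist a b.
Proof.
by have [[y -> ->]|[c -> ->]] := glueQP b => //=; rewrite cross_dist_P.
Qed.

Lemma glue_cover (u : glue) : (exists a, u = glueP a) \/ (exists b, u = glueQ b).
Proof.
case: u => [a|b]; first by left; exists a.
right; exists (val b); have [[y yb _]|[b' /val_inj <- ->]//] := glueQP (val b).
by move: (valP b); rewrite yb codom_f.
Qed.

Lemma glue_distC u v : glue_dist u v = glue_dist v u.
Proof.
have [_ pC _] := dp; have [_ qC _] := dq.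
by case: u v => [a|b] [a'|b'] //=.
Qed.

Lemma glue_ultra : ultrametric glue_dist.
Proof.
have [p0 pC pM] := dp; have [q0 qC qM] := dq.
split; last 2 [exact: glue_distC].
- have neq a (b : {b : q | b \notin codom (mplus q)}) :
    cross_dist a (val b) != 0.
    apply/eqP => ab0; have [y] := cross_dist_ex a (val b).
    rewrite ab0 => /esym y0; have : D a (val b) y <= 0 by rewrite y0.
    rewrite ge_max => /andP[_]; rewrite le_eqVlt ltNge ultrametric_ge0//= orbF.
    by move=> /eqP/q0 yb; case/negP: (valP b); rewrite -[X in X \in _]yb codom_f.
  move=> [a|b] [a'|b'] /=.
  + by split=> [/p0 ->//|[->]]; exact/p0.
  + by split=> [/eqP|//]; rewrite (negbTE (neq _ _)).
  + by split=> [/eqP|//]; rewrite (negbTE (neq _ _)).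
  + by split=> [/q0/val_inj ->//|[->]]; exact/q0.
have PPQ a a' b : cross_dist a b <= Num.max (fdist a a') (cross_dist a' b).
  have [y ->] := cross_dist_ex a' b; rewrite (le_trans (cross_dist_le _ _ y))//.
  by rewrite /D maxA ge_max le_max pM/= le_max lexx orbT.
have PQQ a b b' : cross_dist a b <= Num.max (cross_dist a b') (fdist b' b).
  have [y ->] := cross_dist_ex a b'; rewrite (le_trans (cross_dist_le _ _ y))//.
  by rewrite /D -maxA ge_max le_max lexx/= le_max qM orbT.
have PQP a b a' : fdist a a' <= Num.max (cross_dist a b) (cross_dist a' b).
  have [y ->] := cross_dist_ex a b; have [y' ->] := cross_dist_ex a' b.
  rewrite /D; set M := Num.max _ _.
  have [M1 M2 M3 M4] : [/\ fdist a (mminus p y) <= M, fdist (mplus q y) b <= M,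
      fdist a' (mminus p y') <= M & fdist (mplus q y') b <= M].
    by rewrite /M !le_max !lexx !orbT.
  rewrite (le_trans (pM a (mminus p y) _))// ge_max M1/=.
  rewrite (le_trans (pM _ (mminus p y') _))// ge_max [fdist _ a']pC M3 andbT.
  rewrite dYpq (le_trans (qM _ b _))// ge_max M2/=.
  by rewrite [fdist b _]qC.
have QPQ b a b' : fdist b b' <= Num.max (cross_dist a b) (cross_dist a b').
  have [y ->] := cross_dist_ex a b; have [y' ->] := cross_dist_ex a b'.
  rewrite /D; set M := Num.max _ _.
  have [M1 M2 M3 M4] : [/\ fdist a (mminus p y) <= M, fdist (mplus q y) b <= M,
      fdist a (mminus p y') <= M & fdist (mplus q y') b' <= M].
    by rewrite /M !le_max !lexx !orbT.
  rewrite (le_trans (qM b (mplus q y) _))// ge_max [fdist b _]qC M2/=.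
  rewrite (le_trans (qM _ (mplus q y') _))// ge_max M4 andbT.
  rewrite -dYpq (le_trans (pM _ a _))// ge_max M3 andbT.
  by rewrite [fdist _ a]pC.
move=> [a|b] [a'|b'] [a''|b''] /=.
- exact: pM.
- exact: PPQ.
- exact: PQP.
- exact: PQQ.
- by rewrite maxC pC.
- exact: QPQ.
- by rewrite maxC qC.
- exact: qM.
Qed.

Lemma glue_spec : spectrum glue_dist `<=` Lam.
Proof.
have cr a b r : r != 0 -> cross_dist a b = r -> Lam r.
  move=> r0; have [y ->] := cross_dist_ex a b; rewrite /D.
  by case: leP => _ dr; apply: (@fu_spec _ _ _ r); split=> //;
    [exists (mplus q y), b|exists a, (mminus p y)].
move=> r [r0 [[a|b] [[a'|b'] /= uv]]].
- by apply: (@fu_spec _ _ p); split=> //; exists a, a'.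
- exact: cr uv.
- exact: cr uv.
- by apply: (@fu_spec _ _ q); split=> //; exists (val b), (val b').
Qed.

Definition comp_pred : pred glue :=
  [pred u | (u \in codom (fun x => glueP (mplus p x)))
         || (u \in codom (fun z => glueQ (mminus q z)))].

Definition comp_type : finType := {u : glue | comp_pred u}.

Definition comp_space : finUltra Lam :=
  @FinUltra R Lam comp_type (fun u v => glue_dist (val u) (val v))
    (ultrametric_pull val_inj glue_ultra)
    (subset_trans (@spectrum_pull _ _ _ _ val) glue_spec).

Lemma comp_plus_in x : comp_pred (glueP (mplus p x)).
Proof. by apply/orP; left; exact: (codom_f (fun x => glueP (mplus p x))). Qed.

Lemma comp_minus_in z : comp_pred (glueQ (mminus q z)).
Proof. by apply/orP; right; exact: (codom_f (fun z => glueQ (mminus q z))). Qed.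

Definition comp_plus (x : X) : comp_space := exist comp_pred _ (comp_plus_in x).
Definition comp_minus (z : Z) : comp_space := exist comp_pred _ (comp_minus_in z).

Lemma comp_plus_iso : isometric (@fdist _ _ X) (@fdist _ _ comp_space) comp_plus.
Proof. by move=> x x'; rewrite -(mplus_iso p). Qed.

Lemma comp_minus_iso : isometric (@fdist _ _ Z) (@fdist _ _ comp_space) comp_minus.
Proof. by move=> z z'; rewrite -(mminus_iso q) -glueQ_iso. Qed.

Lemma comp_cover (a : comp_space) :
  (exists x, a = comp_plus x) \/ (exists z, a = comp_minus z).
Proof.
by case: (orP (valP a)) => /codomP[t tE]; [left|right]; exists t; exact: val_inj.
Qed.

(* mor_comp q p is q \diamond p, from X to Z. *)
Definition mor_comp : mor X Z :=
  Mor comp_plus_iso comp_minus_iso comp_cover.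

Lemma mor_compE x z :
  fdist (mplus mor_comp x) (mminus mor_comp z) =
  cross_dist (mplus p x) (mminus q z).
Proof. by rewrite -glueP_Q. Qed.

End Glue.

Lemma mor_comp_eqv (X Y Z : kobj) (p p' : mor X Y) (q q' : mor Y Z) :
  mor_eqv p p' -> mor_eqv q q' -> mor_eqv (mor_comp q p) (mor_comp q' p').
Proof.
move=> /mor_eqvP pp' /mor_eqvP qq'; apply/mor_eqvP => x z.
rewrite !mor_compE /cross_dist pp' qq'.
by apply: eq_bigr => y _; rewrite pp' qq'.
Qed.

Lemma mor_inv_eqv (X Y : kobj) (p p' : mor X Y) :
  mor_eqv p p' -> mor_eqv (mor_inv p) (mor_inv p').
Proof. by move=> [pi [? ? ? ?]]; exists pi. Qed.

End Category.
Arguments kobj {R} Lam.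

Section Hilbert.
Context {R : realType}.

Record hilbert := Hilbert {
  hilb_sort :> completeNormedModType R[i];
  inner : {dot hilb_sort for (@Num.conj R[i])};
  inner_norm : forall v : hilb_sort, `|v| ^+ 2 = inner v v }.

End Hilbert.
Arguments hilbert R : clear implicits.

Section HilbertTheory.
Context {R : realType} {H : hilbert R}.
Notation "'[ u , v ]" := (inner H u v).

Lemma inner_ge0 (u : H) : 0 <= '[u, u].
Proof. exact: dnorm_ge0. Qed.

Lemma innerC (u v : H) : '[u, v] = ('[v, u])^*.
Proof. by rewrite hermC/= expr0 mul1r. Qed.

Lemma norm_inner (v : H) : `|v| = sqrtC '[v, v].
Proof. by rewrite -inner_norm sqrCK. Qed.

Lemma cauchy_schwarz (u v : H) : `|'[u, v]| <= `|u| * `|v|.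
Proof.
have [->|v0] := eqVneq v 0.
  by rewrite (linear0r (inner H)) normr0 normr0 mulr0.
have vv : 0 < '[v, v] by rewrite neq0_dnorm_gt0.
rewrite -(@ler_sqr R[i]) ?nnegrE ?mulr_ge0// exprMn !inner_norm.
have := inner_ge0 (u - ('[u, v] / '[v, v]) *: v).
set c := '[u, v]; set q := '[v, v].
have qC : q^* = q by rewrite conj_Creal// gtr0_real.
rewrite dnormB dnormZ linearZr_LR/= -/c -/q => h.
have : 0 <= '[u, u] * q - `|c| ^+ 2.
  rewrite (_ : _ - _ = ('[u, u] + `|c / q| ^+ 2 * q -
    ((c / q)^* * c + ((c / q)^* * c)^*)) * q) ?mulr_ge0 ?(ltW vv)//.
  rewrite !rmorphM/= conjCK !fmorphV/= !qC ?conjCK normf_div (ger0_norm (ltW vv)) expr_div_n !normCK -/q.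
  by field; rewrite gt_eqF.
by rewrite subr_ge0.
Qed.

Lemma inner_eq0 (u : H) : '[u, u] = 0 -> u = 0.
Proof. by move/eqP; rewrite dnorm_eq0 => /eqP. Qed.

End HilbertTheory.

Section ClosedSubspace.
Context {R : realType}.

Record closed_subspace (H : hilbert R) := ClosedSubspace {
  cs_set :> set H;
  cs_0 : cs_set 0;
  cs_lin : forall (a : R[i]) u v, cs_set u -> cs_set v -> cs_set (a *: u + v);
  cs_closed : closed cs_set }.

Context {H : hilbert R} (S : closed_subspace H).

Definition cs_pred : {pred H} := fun v => `[< cs_set S v >].

Lemma cs_predP v : reflect (cs_set S v) (v \in cs_pred).
Proof. exact: asboolP. Qed.

Lemma cs_submod : submod_closed cs_pred.
Proof.
split=> [|a u v /cs_predP Su /cs_predP Sv]; first by apply/cs_predP; exact: cs_0.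
by apply/cs_predP; exact: cs_lin.
Qed.
HB.instance Definition _ := GRing.isSubmodClosed.Build R[i] H cs_pred cs_submod.

Record subsp := Subsp { subsp_val : H; _ : subsp_val \in cs_pred }.

HB.instance Definition _ := [isSub for subsp_val].
HB.instance Definition _ := [Choice of subsp by <:].
HB.instance Definition _ := [SubChoice_isSubLmodule of subsp by <:].

Lemma subspP (u : subsp) : cs_set S (val u).
Proof. by apply/cs_predP; exact: (valP u). Qed.

Definition subsp_norm (u : subsp) : R[i] := `|val u|.

Lemma subsp_normD (u v : subsp) : subsp_norm (u + v) <= subsp_norm u + subsp_norm v.
Proof. by rewrite /subsp_norm raddfD/= ler_normD. Qed.

Lemma subsp_normZ (a : R[i]) (u : subsp) : subsp_norm (a *: u) = `|a| * subsp_norm u.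
Proof. by rewrite /subsp_norm linearZ/= normrZ. Qed.

Lemma subsp_norm0 (u : subsp) : subsp_norm u = 0 -> u = 0.
Proof. by move=> /eqP; rewrite normr_eq0 => /eqP u0; apply: val_inj; rewrite u0 raddf0. Qed.

HB.instance Definition _ :=
  Lmodule_isNormed.Build R[i] subsp subsp_normD subsp_normZ subsp_norm0.

Lemma subsp_cauchy (F : set_system subsp) : ProperFilter F -> cauchy F -> cvg F.
Proof.
move=> FF /cauchyP Fc.
pose G : set_system H := (val : subsp -> H) @ F.
have Gc : cauchy G.
  apply/cauchyP => e e0; have [x Fx] := Fc _ e0; exists (val x).
  suff : F (val @^-1` ball (val x) e) by [].
  apply: filterS Fx => y; rewrite /preimage/=.
  by rewrite -!ball_normE/= -(raddfB (val : subsp -> H)).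
have /cvg_ex[l Gl] : cvg G by exact: cauchy_cvg.
have Sl : l \in cs_pred.
  apply/cs_predP; apply: (closed_cvg (cs_set S)) Gl; first exact: cs_closed.
  by apply: nearW => x; exact: subspP.
apply/cvg_ex; pose l' := Subsp Sl; have l'E : l = val l' by []; exists l'; apply/cvgrPdist_lt => e e0.
move/cvgrPdist_lt : Gl => /(_ e e0).
by apply: filterS => x; rewrite l'E -(raddfB (val : subsp -> H)).
Qed.

HB.instance Definition _ := Uniform_isComplete.Build subsp subsp_cauchy.

Definition subsp_inner (u v : subsp) : R[i] := inner H (val u) (val v).

Lemma subsp_inner_bilinear :
  bilinear_for ( *%R ) (@Num.conj R[i] \; *%R) subsp_inner.
Proof.
have vP (a : R[i]) (u v : subsp) : val (a *: u + v) = a *: val u + val v.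
  by rewrite linearP.
split=> w a u v /=; rewrite /subsp_inner vP.
  by rewrite linearDl/= linearZl_LR.
by rewrite linearDr/= linearZr_LR.
Qed.
HB.instance Definition _ := bilinear_isBilinear.Build R[i] subsp subsp R[i]
   ( *%R ) (@Num.conj R[i] \; *%R) subsp_inner subsp_inner_bilinear.

Lemma subsp_inner_herm u v :
  subsp_inner u v = (-1) ^+ false * Num.conj (subsp_inner v u).
Proof. by rewrite /subsp_inner hermC. Qed.
HB.instance Definition _ := isHermitianSesquilinear.Build R[i] subsp false
  (@Num.conj R[i]) subsp_inner subsp_inner_herm.

Lemma subsp_inner_gt0 u : u != 0 -> 0 < subsp_inner u u.
Proof.
move=> u0; apply: neq0_dnorm_gt0; apply: contra_neq u0 => u0.
by apply: val_inj; rewrite u0 raddf0.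
Qed.
HB.instance Definition _ := isDotProduct.Build R[i] subsp subsp_inner subsp_inner_gt0.

Lemma subsp_inner_norm (v : subsp) : `|v| ^+ 2 = subsp_inner v v.
Proof. exact: inner_norm. Qed.

Definition subhilb : hilbert R := @Hilbert R subsp subsp_inner subsp_inner_norm.

End ClosedSubspace.

Section Projection.
Context {R : realType} {H : hilbert R} (S : closed_subspace H).
Notation "'[ u , v ]" := (inner H u v).
Local Notation toC := (@real_complex_def R (Phant R)).

Lemma gt0_complex (e : R[i]) : 0 < e -> exists2 r : R, 0 < r & e = toC r.
Proof.
by case: e => a b; rewrite ltcE/= => /andP[/eqP -> a0]; exists a.
Qed.

Lemma ge0_complex (e : R[i]) : 0 <= e -> e = toC (complex.Re e).
Proof. by case: e => a b; rewrite lecE/= => /andP[/eqP -> a0]. Qed.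

Lemma inner_subZ (x u : H) : u != 0 ->
  '[x - ('[x, u] / '[u, u]) *: u, x - ('[x, u] / '[u, u]) *: u] =
  '[x, x] - `|'[x, u]| ^+ 2 / '[u, u].
Proof.
move=> u0; have uu : 0 < '[u, u] by rewrite neq0_dnorm_gt0.
set c := '[x, u]; set q := '[u, u].
have qC : q^* = q by rewrite conj_Creal// gtr0_real.
rewrite dnormB dnormZ linearZr_LR/= -/c -/q.
rewrite !rmorphM/= conjCK !fmorphV/= !qC ?conjCK normf_div (ger0_norm (ltW uu)) expr_div_n !normCK -/q.
by field; rewrite gt_eqF.
Qed.

Lemma cs_setZ a u : cs_set S u -> cs_set S (a *: u).
Proof. by move=> Su; rewrite -[_ *: _]addr0; apply: cs_lin => //; exact: cs_0. Qed.

Lemma cs_setD u v : cs_set S u -> cs_set S v -> cs_set S (u + v).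
Proof. by move=> Su Sv; rewrite -[u]scale1r; exact: cs_lin. Qed.

Lemma parallelogram (x y : H) :
  '[x - y, x - y] = 2 * '[x, x] + 2 * '[y, y] - '[x + y, x + y].
Proof. by rewrite dnormB dnormD/=; ring. Qed.

Lemma projection_ex (v : H) :
  exists w : subhilb S, forall u : subhilb S, '[v - val w, val u] = 0.
Proof.
pose Q w := '[v - w, v - w].
pose E := [set complex.Re (Q w) | w in cs_set S].
have E0 : has_inf E.
  split; first by exists (complex.Re (Q 0)), 0 => //; exact: cs_0.
  exists 0 => _ [w Sw <-]; have := inner_ge0 (v - w).
  by rewrite lecE => /andP[].
pose d := inf E.
have dQ w : cs_set S w -> toC d <= Q w.
  move=> Sw; rewrite /Q (ge0_complex (inner_ge0 (v - w))) lecR.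
  by apply: ge_inf; [exact: E0.2|exists w].
pose A (e : R) := [set w | cs_set S w /\ Q w < toC d + (toC e) ^+ 2].
pose F := filter_from [set e : R | 0 < e] A.
have FF : ProperFilter F.
  apply: filter_from_proper; last first.
    move=> e /= e0; have [_ [w Sw <-] wd] := inf_adherent (exprn_gt0 2 e0) E0.
    exists w; split => //; rewrite /Q (ge0_complex (inner_ge0 (v - w))).
    by rewrite -rmorphXn/= -rmorphD/= ltcR.
  apply: filter_from_filter; first by exists 1 => /=.
  have Ale (e e' : R) : 0 < e -> e <= e' -> A e `<=` A e'.
    move=> e0 ee' w [Sw we]; split=> //; apply: lt_le_trans we _.
    by rewrite lerD2l lerXn2r ?nnegrE ?lecR// ltW// (lt_le_trans e0).
  move=> e e' /= e0 e'0; exists (Num.min e e'); first by rewrite /= lt_min e0.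
  by rewrite subsetI; split; apply: Ale; rewrite ?lt_min ?e0 ?ge_min ?lexx ?orbT.
have Fc : cauchy F.
  apply/cauchyP => _/gt0_complex[e e0 ->].
  have e2 : 0 < e / 2 by rewrite divr_gt0.
  have [w [Sw wd]] : A (e / 2) !=set0 by apply: (@filter_ex _ F); exists (e / 2).
  exists w; exists (e / 2) => // w' [Sw' w'd].
  rewrite -ball_normE/= -(@ltr_sqr R[i]) ?nnegrE ?lecR ?(ltW e0)//.
  rewrite inner_norm (_ : w - w' = (v - w') - (v - w)); last first.
    by rewrite opprB [RHS]addrC addrA subrK.
  rewrite parallelogram.
  have /dQ : cs_set S (2^-1 *: (w + w')) by apply: cs_setZ; exact: cs_setD.
  rewrite /Q.
  rewrite (_ : v - w' + (v - w) = 2 *: (v - 2^-1 *: (w + w'))); last first.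
    rewrite scalerBr scalerA divff// scale1r scaler_nat mulr2n opprD addrACA.
    by rewrite [- w' - w]addrC.
  rewrite dnormZ ger0_norm//.
  move: wd w'd; rewrite /Q rmorphM/= fmorphV/= rmorph_nat expr_div_n.
  set a := '[_, _]; set b := '[_, _]; set c := '[_, _]; set f := toC e ^+ 2.
  move=> ha hb hc.
  rewrite (@lt_le_trans _ _ (2 * (toC d + f / 2 ^+ 2) + 2 * (toC d + f / 2 ^+ 2) - 2 ^+ 2 * toC d))//.
    rewrite ltr_leB// ?ltrD ?ltr_pM2l//.
    by rewrite ler_pM2l// exprn_gt0.
  by rewrite le_eqVlt; apply/orP; left; apply/eqP; field.
have /cvg_ex[l Fl] : cvg F by exact: cauchy_cvg.
have Sl : l \in cs_pred S.
  apply/cs_predP; apply: (@closed_cvg _ _ F _ id (cs_set S) _ _ l Fl).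
    exact: cs_closed.
  by exists 1 => //= w [].
exists (Subsp Sl) => u /=.
have [->|u0] := eqVneq (val u) 0; first by rewrite linear0r.
set c := '[_, _]; apply/eqP; rewrite -normr_le0; apply/ler_addgt0Pl => e e0.
have nu : 0 < `|val u| by rewrite normr_gt0.
have [r r0 rE] : exists2 r, 0 < r & e / `|val u| / 2 = toC r.
  by apply: gt0_complex; rewrite !divr_gt0.
have [w [[Sw wd] /= lw]] : (A r `&` [set w | `|l - w| < toC r]) !=set0.
  apply: (@filter_ex _ F); apply: filterI; first by exists r.
  by move/fcvgrPdist_lt : Fl; apply; rewrite ltcR.
have -> : c = '[v - w, val u] - '[l - w, val u].
  by rewrite -linearBl/= opprB addrA subrK.
rewrite (le_trans (ler_normB _ _))// addr0.
have : `|'[v - w, val u]| <= toC r * `|val u|.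
  have r0C : 0 <= toC r by rewrite lecR ltW.
  rewrite -(@ler_sqr R[i]) ?nnegrE ?normr_ge0 ?mulr_ge0 ?normr_ge0//.
  rewrite exprMn inner_norm -ler_pdivrMr ?neq0_dnorm_gt0//.
  set t := '[v - w, val u] / '[val u, val u].
  have /dQ : cs_set S (w + t *: val u).
    by apply: cs_setD => //; apply: cs_setZ; exact: subspP.
  rewrite /Q opprD addrA inner_subZ// lerBrDr => /le_lt_trans/(_ wd).
  by rewrite ltrD2l => /ltW.
move=> h; have := cauchy_schwarz (l - w) (val u) => h'.
rewrite (_ : e = toC r * `|val u| + toC r * `|val u|).
  by rewrite lerD// (le_trans h')// ler_wpM2r// ltW.
by rewrite -rE; field; rewrite gt_eqF.
Qed.

End Projection.

Section Operators.
Context {R : realType}.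

Record bounded_op (V W : hilbert R) := BoundedOp {
  bop_fun :> V -> W;
  bop_linear : linear bop_fun;
  bop_bounded : exists M : R, forall v, `|bop_fun v| <= M%:C%C * `|v| }.

Definition opnorm (V W : hilbert R) (T : bounded_op V W) : R :=
  sup [set complex.Re `|T v| | v in [set v : V | `|v| <= 1]].

Definition is_adjoint (V W : hilbert R) (T : bounded_op V W)
    (S : bounded_op W V) : Prop :=
  forall v w, inner W (T v) w = inner V v (S w).

HB.instance Definition _ (V W : hilbert R) := gen_eqMixin (bounded_op V W).
HB.instance Definition _ (V W : hilbert R) := gen_choiceMixin (bounded_op V W).

Definition matrix_coef (V W : hilbert R) (T : bounded_op V W) :
  {ptws V * W -> R[i]^o} := fun vw => inner W (T vw.1) vw.2.

(* Weak operator topology: initial for the maps T |-> <T v, w>. *)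
Definition wot (V W : hilbert R) : Type := initial_topology (@matrix_coef V W).
HB.instance Definition _ (V W : hilbert R) :=
  Topological.copy (wot V W) (initial_topology (@matrix_coef V W)).

End Operators.

Section OrthogonalProjection.
Context {R : realType} {H : hilbert R} (S : closed_subspace H).

Definition proj (v : H) : subhilb S := projT1 (cid (projection_ex S v)).

Lemma proj_orth v (u : subhilb S) : inner H (v - val (proj v)) (val u) = 0.
Proof. exact: (projT2 (cid (projection_ex S v))). Qed.

Lemma proj_uniq v (w : subhilb S) :
  (forall u : subhilb S, inner H (v - val w) (val u) = 0) -> proj v = w.
Proof.
move=> vw; apply/eqP; rewrite -subr_eq0; apply/eqP/val_inj/inner_eq0.
set u := proj v - w.
have uE : val u = (v - val w) - (v - val (proj v)).
  by rewrite /u (raddfB (val : subsp S -> H)) opprB [RHS]addrC addrA subrK.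
transitivity (inner H (v - val w) (val u) - inner H (v - val (proj v)) (val u)).
  by rewrite -linearBl/= -uE.
by rewrite vw proj_orth subr0.
Qed.

Lemma proj_linear : linear proj.
Proof.
move=> a u v; apply: proj_uniq => w.
rewrite (linearP (val : subsp S -> H)) opprD addrACA -scalerBr.
by rewrite linearDl/= linearZl_LR/= !proj_orth mulr0 addr0.
Qed.

Lemma norm_proj v : `|proj v| <= `|v|.
Proof.
rewrite -(@ler_sqr R[i]) ?nnegrE ?normr_ge0// !inner_norm.
have vE : v = (v - val (proj v)) + val (proj v) by rewrite subrK.
rewrite [X in _ <= inner H X X]vE hnormDd; last exact: proj_orth.
by rewrite lerDr inner_ge0.
Qed.

End OrthogonalProjection.

Section BijectionInverse.
Context {T : Type} (f : T -> T).

Definition bij_inv (fB : bijective f) : T -> T :=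
  projT1 (cid (let: Bijective g fK gK := fB in
               ex_intro (fun g => cancel f g /\ cancel g f) g (conj fK gK))).

Lemma bij_invK (fB : bijective f) : cancel f (bij_inv fB).
Proof. by rewrite /bij_inv; case: cid => g []. Qed.

Lemma bij_invVK (fB : bijective f) : cancel (bij_inv fB) f.
Proof. by rewrite /bij_inv; case: cid => g []. Qed.

Lemma bij_inv_bij (fB : bijective f) : bijective (bij_inv fB).
Proof. by exists f; [exact: bij_invVK|exact: bij_invK]. Qed.

End BijectionInverse.

Section IsometryGroup.
Context {R : realType} (U : metricType R).

Record isom := Isom {
  isom_fun :> U -> U;
  isom_bij : bijective isom_fun;
  isom_iso : isometric (@mdist R U) (@mdist R U) isom_fun }.

Lemma isom_ext (f g : isom) : f =1 g -> f = g.
Proof.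
case: f g => [f f1 f2] [g g1 g2] /= /funext fg; rewrite fg in f1 f2 *.
by congr Isom; exact: Prop_irrelevance.
Qed.

HB.instance Definition _ := gen_eqMixin isom.
HB.instance Definition _ := gen_choiceMixin isom.

Definition isom_one : isom :=
  @Isom idfun (Bijective (frefl _) (frefl _)) (fun _ _ => erefl).

Lemma isom_mul_iso (f g : isom) :
  isometric (@mdist R U) (@mdist R U) (f \o g).
Proof. by move=> x y; rewrite /= !isom_iso. Qed.

Definition isom_mul (f g : isom) : isom :=
  Isom (bij_comp (isom_bij f) (isom_bij g)) (isom_mul_iso f g).

Lemma isom_inv_iso (f : isom) :
  isometric (@mdist R U) (@mdist R U) (bij_inv (isom_bij f)).
Proof. by move=> x y; rewrite -(isom_iso f) !bij_invVK. Qed.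

Definition isom_inv (f : isom) : isom :=
  Isom (bij_inv_bij (isom_bij f)) (isom_inv_iso f).

Lemma isom_mulA : associative isom_mul.
Proof. by move=> f g h; exact: isom_ext. Qed.

Lemma isom_mul1 : left_id isom_one isom_mul.
Proof. by move=> f; exact: isom_ext. Qed.

Lemma isom_1mul : right_id isom_one isom_mul.
Proof. by move=> f; exact: isom_ext. Qed.

Lemma isom_mulV : left_inverse isom_one isom_inv isom_mul.
Proof. by move=> f; apply: isom_ext => x /=; rewrite bij_invK. Qed.

Lemma isom_Vmul : right_inverse isom_one isom_inv isom_mul.
Proof. by move=> f; apply: isom_ext => x /=; rewrite bij_invVK. Qed.

HB.instance Definition _ :=
  isGroup.Build isom isom_mulA isom_mul1 isom_1mul isom_mulV isom_Vmul.

Definition isom_ptws (g : isom) : {ptws U -> U} := g.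

HB.instance Definition _ := Topological.copy isom (initial_topology isom_ptws).

End IsometryGroup.

Section UnitaryGroup.
Context {R : realType} (H : hilbert R).

Record unitary := Unitary {
  unitary_fun :> H -> H;
  unitary_linear : linear unitary_fun;
  unitary_bij : bijective unitary_fun;
  unitary_inner : forall v w,
    inner H (unitary_fun v) (unitary_fun w) = inner H v w }.

Lemma unitary_ext (f g : unitary) : f =1 g -> f = g.
Proof.
case: f g => [f f1 f2 f3] [g g1 g2 g3] /= /funext fg; rewrite fg in f1 f2 f3 *.
by congr Unitary; exact: Prop_irrelevance.
Qed.

HB.instance Definition _ := gen_eqMixin unitary.
HB.instance Definition _ := gen_choiceMixin unitary.

Definition unitary_one : unitary :=
  @Unitary idfun (fun _ _ _ => erefl) (Bijective (frefl _) (frefl _))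
    (fun _ _ => erefl).

Lemma unitary_mul_linear (f g : unitary) : linear (f \o g).
Proof. by move=> a u v; rewrite /= !unitary_linear. Qed.

Lemma unitary_mul_inner (f g : unitary) v w :
  inner H ((f \o g) v) ((f \o g) w) = inner H v w.
Proof. by rewrite /= !unitary_inner. Qed.

Definition unitary_mul (f g : unitary) : unitary :=
  Unitary (unitary_mul_linear f g) (bij_comp (unitary_bij f) (unitary_bij g))
    (unitary_mul_inner f g).

Lemma unitary_inv_linear (f : unitary) : linear (bij_inv (unitary_bij f)).
Proof.
move=> a u v; apply: (bij_inj (unitary_bij f)).
by rewrite unitary_linear !bij_invVK.
Qed.

Lemma unitary_inv_inner (f : unitary) v w :
  inner H (bij_inv (unitary_bij f) v) (bij_inv (unitary_bij f) w) = inner H v w.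
Proof. by rewrite -(unitary_inner f) !bij_invVK. Qed.

Definition unitary_inv (f : unitary) : unitary :=
  Unitary (unitary_inv_linear f) (bij_inv_bij (unitary_bij f))
    (unitary_inv_inner f).

Lemma unitary_mulA : associative unitary_mul.
Proof. by move=> f g h; exact: unitary_ext. Qed.

Lemma unitary_mul1 : left_id unitary_one unitary_mul.
Proof. by move=> f; exact: unitary_ext. Qed.

Lemma unitary_1mul : right_id unitary_one unitary_mul.
Proof. by move=> f; exact: unitary_ext. Qed.

Lemma unitary_mulV : left_inverse unitary_one unitary_inv unitary_mul.
Proof. by move=> f; apply: unitary_ext => x /=; rewrite bij_invK. Qed.

Lemma unitary_Vmul : right_inverse unitary_one unitary_inv unitary_mul.
Proof. by move=> f; apply: unitary_ext => x /=; rewrite bij_invVK. Qed.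

HB.instance Definition _ := isGroup.Build unitary
  unitary_mulA unitary_mul1 unitary_1mul unitary_mulV unitary_Vmul.

Definition unitary_ptws (g : unitary) : {ptws H -> H} := g.

(* On the unitary group, pointwise convergence is the strong operator topology. *)
HB.instance Definition _ :=
  Topological.copy unitary (initial_topology unitary_ptws).

Lemma unitary_norm (f : unitary) v : `|f v| = `|v|.
Proof. by rewrite !norm_inner unitary_inner. Qed.

Lemma unitaryB (f : unitary) u v : f (u - v) = f u - f v.
Proof. by rewrite -[u - v]addrC -scaleN1r unitary_linear scaleN1r addrC. Qed.

End UnitaryGroup.

Section Representation.
Context {R : realType} {Lam : set R}.

Record unirep (U : urysohn Lam) (H : hilbert R) := UniRep {
  rep :> isom U -> unitary H;
  rep_morph : {morph rep : g h / (g * h)%g};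
  rep_cont : continuous rep }.

Record nefset (U : urysohn Lam) := NeFset {
  nef :> {fset U};
  nef_ne : nef != fset0 }.

Section Fixed.
Context {U : urysohn Lam}.

Definition stab (X : nefset U) : set (isom U) :=
  [set g | forall x, x \in nef X -> g x = x].

Lemma fset_spec (A : {fset U}) :
  spectrum (fun x y : A => mdist (val x) (val y)) `<=` Lam.
Proof.
rewrite -[X in _ `<=` X](ury_spec U).
exact: (@spectrum_pull _ _ _ (@mdist R U) val).
Qed.

Definition fset_ultra (A : {fset U}) : finUltra Lam :=
  @FinUltra R Lam A (fun x y => mdist (val x) (val y))
    (ultrametric_pull val_inj (ury_ultra U)) (@fset_spec A).

Lemma nefset_card (X : nefset U) : (0 < #|fset_ultra X|)%N.
Proof. by rewrite -cardfE cardfs_gt0 nef_ne. Qed.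

Definition obj (X : nefset U) : kobj Lam := KObj (nefset_card X).

Section MorphismOf.
Context (X Y : nefset U) (g : isom U).

Definition mor_of_fset : {fset U} := (Y `|` [fset g x | x in nef X])%fset.

Lemma mor_of_plus_in (x : obj X) : g (val x) \in mor_of_fset.
Proof. by rewrite in_fsetU in_imfset ?orbT//=; exact: valP. Qed.

Lemma mor_of_minus_in (y : obj Y) : val y \in mor_of_fset.
Proof. by rewrite in_fsetU (valP y). Qed.

Definition mor_of_plus (x : obj X) : fset_ultra mor_of_fset :=
  FSetSub (mor_of_plus_in x).
Definition mor_of_minus (y : obj Y) : fset_ultra mor_of_fset :=
  FSetSub (mor_of_minus_in y).

Lemma mor_of_plus_iso :
  isometric (@fdist _ _ (obj X)) (@fdist _ _ (fset_ultra mor_of_fset)) mor_of_plus.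
Proof. by move=> x y; exact: isom_iso. Qed.

Lemma mor_of_minus_iso :
  isometric (@fdist _ _ (obj Y)) (@fdist _ _ (fset_ultra mor_of_fset)) mor_of_minus.
Proof. by []. Qed.

Lemma mor_of_cover (a : fset_ultra mor_of_fset) :
  (exists x, a = mor_of_plus x) \/ (exists y, a = mor_of_minus y).
Proof.
have := valP a; rewrite in_fsetU => /orP[aY|/imfsetP[x/= xX ax]].
  by right; exists [` aY]%fset; exact: val_inj.
by left; exists [` xX]%fset; exact: val_inj.
Qed.

Definition mor_of : mor (obj X) (obj Y) :=
  Mor mor_of_plus_iso mor_of_minus_iso mor_of_cover.

End MorphismOf.

Lemma mor_ofE (X Y : nefset U) g (x : obj X) (y : obj Y) :
  fdist (mplus (mor_of X Y g) x) (mminus (mor_of X Y g) y) =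
  mdist (g (val x)) (val y).
Proof. by []. Qed.

Section DoubleCosets.
Context (X Y : nefset U).

Definition dcoset_rel (g g' : isom U) : bool :=
  `[< exists k h, [/\ stab Y k, stab X h & g' = (k * g * h)%g] >].

Lemma stab1 Z : stab Z 1%g.
Proof. by []. Qed.

Lemma stabM Z g h : stab Z g -> stab Z h -> stab Z (g * h)%g.
Proof. by move=> gZ hZ x xZ; rewrite -[RHS](gZ _ xZ) -[in RHS](hZ _ xZ). Qed.

Lemma stabV Z g : stab Z g -> stab Z g^-1%g.
Proof. by move=> gZ x xZ; rewrite -[in LHS](gZ _ xZ); exact: bij_invK. Qed.

Lemma dcoset_refl : reflexive dcoset_rel.
Proof.
move=> g; apply/asboolP; exists 1%g, 1%g.
by split; [exact: stab1|exact: stab1|rewrite mul1g mulg1].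
Qed.

Lemma dcoset_sym : symmetric dcoset_rel.
Proof.
have s g g' : dcoset_rel g g' -> dcoset_rel g' g.
  move=> /asboolP[k [h [kY hX ->]]]; apply/asboolP; exists k^-1%g, h^-1%g.
  by split; [exact: stabV|exact: stabV|rewrite !mulgA mulVg mul1g mulgK].
by move=> g g'; apply/idP/idP; exact: s.
Qed.

Lemma dcoset_trans : transitive dcoset_rel.
Proof.
move=> g2 g1 g3 /asboolP[k [h [kY hX ->]]] /asboolP[k' [h' [kY' hX' ->]]].
apply/asboolP; exists (k' * k)%g, (h * h')%g.
by split; [exact: stabM|exact: stabM|rewrite !mulgA].
Qed.

Canonical dcoset_equiv := EquivRel dcoset_rel dcoset_refl dcoset_sym dcoset_trans.

Definition dcoset := quotient_topology {eq_quot dcoset_equiv}%qT.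

Definition dcoset_mor (c : dcoset) : mor (obj X) (obj Y) := mor_of X Y (repr c).

Lemma mor_of_dcoset g g' : dcoset_rel g g' ->
  mor_eqv (mor_of X Y g) (mor_of X Y g').
Proof.
move=> /asboolP[k [h [kY hX ->]]]; apply/mor_eqvP => x y; rewrite !mor_ofE.
have hx : h (val x) = val x by exact: hX _ (valP x).
have ky : k (val y) = val y by exact: kY _ (valP y).
rewrite (_ : (k * g * h)%g (val x) = k (g (h (val x))))// hx.
by rewrite -[in RHS]ky isom_iso.
Qed.

End DoubleCosets.

Context {H : hilbert R} (rho : unirep U H).

Section FixedSpace.
Context (X : nefset U).

Definition fixed_set : set H :=
  [set v | forall g, stab X g -> rho g v = v].

Lemma fixed_set0 : fixed_set 0.
Proof. by move=> g _; have := unitaryB (rho g) 0 0; rewrite !subrr. Qed.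

Lemma fixed_set_lin (a : R[i]) u v :
  fixed_set u -> fixed_set v -> fixed_set (a *: u + v).
Proof. by move=> fu fv g gX; rewrite unitary_linear fu// fv. Qed.

Lemma fixed_set_closed : closed fixed_set.
Proof.
move=> v vX g gX; apply/eqP; rewrite -subr_eq0 -normr_le0.
apply/ler_addgt0Pl => e e0; rewrite addr0.
have [w [wX]] := vX _ (nbhsx_ballx v (e / 2) (divr_gt0 e0 (ltr0n _ 2))).
rewrite -ball_normE/= => vw.
have -> : rho g v - v = rho g (v - w) - (v - w).
  by rewrite unitaryB wX// opprB addrA subrK.
rewrite (le_trans (ler_normB _ _))// unitary_norm [leRHS]splitr.
by rewrite lerD// ltW.
Qed.

Definition fixed : closed_subspace H :=
  ClosedSubspace fixed_set0 fixed_set_lin fixed_set_closed.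

End FixedSpace.

Notation "H[ X ]" := (subhilb (fixed X)).

Section Compression.
Context (X Y : nefset U) (g : isom U).

Definition compress_fun (v : H[X]) : H[Y] := proj (fixed Y) (rho g (val v)).

Lemma compress_linear : linear compress_fun.
Proof.
move=> a u v; rewrite /compress_fun (linearP (val : subsp (fixed X) -> H)).
by rewrite unitary_linear proj_linear.
Qed.

Lemma compress_norm v : `|compress_fun v| <= `|v|.
Proof. by rewrite (le_trans (norm_proj _ _))// unitary_norm. Qed.

Lemma compress_bounded :
  exists M : R, forall v, `|compress_fun v| <= M%:C%C * `|v|.
Proof. by exists 1 => v; rewrite mul1r compress_norm. Qed.

Definition compress : bounded_op H[X] H[Y] :=
  BoundedOp compress_linear compress_bounded.

End Compression.

Lemma proj_rep (Y : nefset U) k w :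
  stab Y k -> proj (fixed Y) (rho k w) = proj (fixed Y) w.
Proof.
move=> kY; apply: proj_uniq => u.
have fixu (t : H[Y]) : rho k (val t) = val t by exact: (subspP t).
rewrite -[X in _ - X]fixu -unitaryB -[X in inner H _ X]fixu unitary_inner.
exact: proj_orth.
Qed.

Lemma compress_dcoset (X Y : nefset U) g g' :
  dcoset_rel X Y g g' -> compress X Y g =1 compress X Y g'.
Proof.
move=> /asboolP[k [h [kY hX ->]]] v.
have hv : rho h (val v) = val v by exact: (subspP v).
have khv : rho (k * g * h)%g (val v) = rho k (rho g (val v)).
  by rewrite !rep_morph -[in RHS]hv.
transitivity (proj (fixed Y) (rho (k * g * h)%g (val v))) => //.
by rewrite khv proj_rep.
Qed.

(* The operator Pi[Y] rho(g) for any g whose morphism X -> Y is p. Such a g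
   exists and is unique up to the double coset I[Y] g I[X], on which the operator
   only depends (compress_dcoset). *)
Definition rhohat (X Y : nefset U) (p : mor (obj X) (obj Y)) :
    bounded_op H[X] H[Y] :=
  compress X Y (xget 1%g [set g | mor_eqv (mor_of X Y g) p]).

Lemma rhohat_eqv (X Y : nefset U) (p p' : mor (obj X) (obj Y)) :
  mor_eqv p p' -> rhohat p = rhohat p'.
Proof.
move=> pp'; rewrite /rhohat; congr (compress X Y (xget _ _)).
apply/seteqP; split=> g /= gp; apply: mor_eqv_trans gp _ => //.
exact: mor_eqv_sym.
Qed.

End Fixed.
End Representation.

(* Main.v *)
Require Import Defs.
From mathcomp Require Import all_boot all_order all_algebra.
From mathcomp Require Import finmap complex.
From mathcomp Require Import all_classical all_reals all_analysis.

Import Order.TTheory GRing.Theory Num.Theory.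
Import numFieldNormedType.Exports.

Local Open Scope classical_set_scope.
Local Open Scope ring_scope.

(* A back-and-forth argument shows that isometries between finite subsets of the
   Urysohn space extend to global isometries, so that a matrix coefficient
   <rho(g) v, w> with v in H[X], w in H[Y] depends only on the distances
   d(g x, y). Multiplicativity amounts to <Pi[Y] rho(h) v, w'> = <rho(r) v, w>,
   where w' = rho(g)^-1 w and r realises the product morphism. Take isometries
   s_n in I[Y] h I[X] such that the sets s_n X are glued freely over Y to one
   another and to g^-1 Z. The vectors e_n = rho(s_n) v have constant Gram
   coefficients, hence a weak limit u. For k in I[Y], the ultrametric inequality
   implies that s_m X is free over Y from k s_n X for all large m; therefore u is
   I[Y]-invariant, u = Pi[Y] rho(h) v, and <u, w'> is the constant value
   <e_n, w'> = <rho(r) v, w>. *)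

(** * Homogeneity: finite partial isometries of the Urysohn space extend to global ones *)

Section CompleteExtension.
Context {R : realType} {Lam : set R} {U : urysohn Lam}.
Local Notation d := (@mdist R U).

Lemma udist0 (x y : U) : d x y = 0 <-> x = y.
Proof. by have [+ _ _] := ury_ultra U; apply. Qed.

Lemma udistC (x y : U) : d x y = d y x.
Proof. by have [_ + _] := ury_ultra U; apply. Qed.

Lemma udist_max (y x z : U) : d x z <= Num.max (d x y) (d y z).
Proof. by have [_ _ +] := ury_ultra U; apply. Qed.

Lemma udist_lt (y x z : U) e : d x y < e -> d y z < e -> d x z < e.
Proof. by move=> xy yz; rewrite (le_lt_trans (udist_max y x z))// gt_max xy. Qed.

Definition partial_isometry (L : set (U * U)) : Prop :=
  forall s t, L s -> L t -> d s.1 t.1 = d s.2 t.2.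

Definition graph_swap (L : set (U * U)) : set (U * U) := [set s | L (s.2, s.1)].

Lemma partial_isometry_swap L :
  partial_isometry L -> partial_isometry (graph_swap L).
Proof. by move=> LP s t Ls Lt; rewrite (LP _ _ Ls Lt). Qed.

(** The closure of [L] in the product space, as a relation; it becomes the graph of the extended
    isometry. *)
Definition graph_closure (L : set (U * U)) (x y : U) : Prop :=
  forall e, 0 < e -> exists2 s, L s & d x s.1 < e /\ d y s.2 < e.

Lemma graph_closure_swap {L x y} :
  graph_closure L x y -> graph_closure (graph_swap L) y x.
Proof.
by move=> + e e0 => /(_ e e0)[[a b] Lab [xa yb]]; exists (b, a).
Qed.

(** Passing to [e]-close pairs of [L] raises a distance at most to its maximum with [e], which gives
    one inequality; exchanging the coordinates gives the other. *)
Lemma graph_closure_isometric {L x y x' y'} : partial_isometry L ->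
  graph_closure L x y -> graph_closure L x' y' -> d x x' = d y y'.
Proof.
have le K u v u' v' : partial_isometry K -> graph_closure K u v ->
    graph_closure K u' v' -> d u u' <= d v v'.
  move=> KP uv uv'; apply/ler_addgt0Pr => e e0.
  have [s Ks [us vs]] := uv _ e0; have [t Kt [ut vt]] := uv' _ e0.
  have uu' : d u u' <= Num.max e (d s.1 t.1).
    rewrite (le_trans (udist_max s.1 _ _))// ge_max le_max ltW//=.
    rewrite (le_trans (udist_max t.1 _ _))// ge_max !le_max lexx orbT/=.
    by rewrite udistC ltW.
  have st : d s.2 t.2 <= Num.max e (d v v').
    rewrite (le_trans (udist_max v _ _))// ge_max le_max udistC ltW//=.
    rewrite (le_trans (udist_max v' _ _))// ge_max !le_max lexx orbT/=.
    by rewrite ltW.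
  rewrite (KP _ _ Ks Kt) in uu'.
  have v0 : 0 <= d v v' by exact: mdist_ge0.
  rewrite (le_trans uu')// ge_max lerDr v0/= (le_trans st)// ge_max lerDr v0/=.
  by rewrite lerDl ltW.
move=> LP xy xy'; apply/eqP; rewrite eq_le; apply/andP; split; first exact: (le L).
by apply: (le (graph_swap L)); [exact: partial_isometry_swap|
  exact: graph_closure_swap|exact: graph_closure_swap].
Qed.

(** The partners of the points of [L] near [x] form a Cauchy filter because [L] preserves distances;
    completeness supplies the limit. *)
Lemma graph_closure_total L : partial_isometry L ->
  (forall x e, 0 < e -> exists2 s, L s & d x s.1 < e) ->
  forall x, exists y, graph_closure L x y.
Proof.
move=> LP Ld x.
pose A (e : R) := [set b | exists2 a, L (a, b) & d x a < e].
pose F := filter_from [set e : R | 0 < e] A.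
have FF : ProperFilter F.
  apply: filter_from_proper; last first.
    by move=> e e0; have [[a b] Lab xa] := Ld x _ e0; exists b, a.
  apply: filter_from_filter; first by exists 1 => /=.
  move=> e e' /= e0 e'0; exists (Num.min e e'); first by rewrite /= lt_min e0.
  by move=> b [a Lab]; rewrite lt_min => /andP[ae ae']; split; exists a.
have Fc : cauchy F.
  apply/cauchyP => e e0; have [[a b] Lab xa] := Ld x _ e0; exists b; exists e => //.
  move=> b' [a' Lab' xa']; rewrite ballEmdist/= -(LP _ _ Lab Lab').
  by apply: (@udist_lt x) => //; rewrite udistC.
have [l Fl] := @ury_complete _ _ U F FF Fc; exists l => e e0.
have /Fl Fe : nbhs l (ball l e) by exact: nbhsx_ballx.
have [b [[a Lab xa]]] : (A e `&` ball l e) !=set0.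
  by apply: (@filter_ex _ F); apply: filterI => //; exists e.
by rewrite ballEmdist/= => lb; exists (a, b).
Qed.

(** The closure is total in both directions, and two partners of one point are at distance zero, so
    it is the graph of a bijective isometry. *)
Lemma partial_isometry_dense_extends L : partial_isometry L ->
  (forall x e, 0 < e -> exists2 s, L s & d x s.1 < e) ->
  (forall y e, 0 < e -> exists2 s, L s & d y s.2 < e) ->
  exists g : isom U, forall s, L s -> g s.1 = s.2.
Proof.
move=> LP Ld Lr; have tot := graph_closure_total L LP Ld.
have tot' : forall y, exists x, graph_closure L x y.
  move=> y; have Ld' z e : 0 < e -> exists2 s, graph_swap L s & d z s.1 < e.
    by move=> e0; have [[a b] Lab zb] := Lr z _ e0; exists (b, a).
  have [x yx] := graph_closure_total _ (partial_isometry_swap L LP) Ld' y.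
  by exists x => e /yx[[b a] Lab [yb xa]]; exists (a, b).
pose f x := projT1 (cid (tot x)).
have fP x : graph_closure L x (f x) := projT2 (cid (tot x)).
pose f' y := projT1 (cid (tot' y)).
have f'P y : graph_closure L (f' y) y := projT2 (cid (tot' y)).
have fK : cancel f f'.
  by move=> x; apply/udist0; rewrite (graph_closure_isometric LP (f'P (f x)) (fP x)) mdistxx.
have f'K : cancel f' f.
  by move=> y; apply/udist0; rewrite -(graph_closure_isometric LP (fP (f' y)) (f'P y)) mdistxx.
have fi : isometric d d f.
  by move=> x y; rewrite (graph_closure_isometric LP (fP x) (fP y)).
exists (@Isom _ _ f (Bijective fK f'K) fi) => -[a b] Lab /=.
have ab : graph_closure L a b by move=> e e0; exists (a, b) => //=; rewrite !mdistxx.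
by apply/udist0; rewrite -(graph_closure_isometric LP (fP a) ab) mdistxx.
Qed.

(** The extension property of [U] is applied to the inclusion of the set [A] of first coordinates
    into [A] with [x] added. *)
Lemma partial_isometry_add (L : seq (U * U)) x :
  partial_isometry [set` L] ->
  exists y, partial_isometry [set` (x, y) :: L].
Proof.
move=> LP.
pose A : {fset U} := [fset s.1 | s in L]%fset.
pose B : {fset U} := (x |` A)%fset.
have AB (a : A) : val a \in B by rewrite in_fsetU (valP a) orbT.
pose i (a : fset_ultra A) : fset_ultra B := FSetSub (AB a).
have iP : isometric (@fdist _ _ (fset_ultra A)) (@fdist _ _ (fset_ultra B)) i.
  by [].
have fex (a : A) : exists b, (val a, b) \in L.
  by have /imfsetP[[u v]/= uvL ->] := valP a; exists v.
pose f (a : fset_ultra A) : U := projT1 (cid (fex a)).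
have fL a : (val a, f a) \in L := projT2 (cid (fex a)).
have fP : isometric (@fdist _ _ (fset_ultra A)) d f.
  by move=> a b; rewrite -(LP _ _ (fL a) (fL b)).
have [h hP hf] := @ury_ext _ _ U _ _ i f iP fP.
have xB : x \in B by rewrite in_fsetU in_fset1 eqxx.
pose x' : fset_ultra B := FSetSub xB.
(* [f] picked one partner per point; a partial isometry is single-valued, so every pair of [L] lies
   on the graph of [h]. *)
have hL s : s \in L -> exists2 a : B, s.1 = val a & s.2 = h a.
  move=> sL; have sA : s.1 \in A by apply/imfsetP; exists s.
  exists (i (FSetSub sA)) => //; rewrite -[h _]/((h \o i) _) hf.
  apply/udist0; rewrite -(LP _ _ sL (fL (FSetSub sA))); exact/udist0.
have {}hL s : s \in (x, h x') :: L -> exists2 a : B, s.1 = val a & s.2 = h a.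
  by rewrite inE => /predU1P[->|/hL//]; exists x'.
exists (h x') => s t /hL[a -> ->] /hL[b -> ->].
by rewrite hP.
Qed.

(** One back-and-forth step: [z] enters the domain directly and the range through the swapped
    list. *)
Lemma partial_isometry_add2 (L : seq (U * U)) z :
  partial_isometry [set` L] -> exists L' : seq (U * U),
    [/\ partial_isometry [set` L'], {subset L <= L'},
      exists y, (z, y) \in L' & exists x, (x, z) \in L'].
Proof.
move=> LP; have [y yP] := partial_isometry_add L z LP.
pose L1 := (z, y) :: L.
pose L2 := [seq (s.2, s.1) | s <- L1].
have [|x xP] := partial_isometry_add L2 z.
  by move=> _ _ /mapP[s sL ->] /mapP[t tL ->] /=; rewrite (yP _ _ sL tL).
have swapL s : s \in (x, z) :: L1 -> (s.2, s.1) \in (z, x) :: L2.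
  rewrite in_cons => /predU1P[->|sL]; first exact: mem_head.
  by rewrite in_cons (map_f (fun s => (s.2, s.1)) sL) orbT.
exists ((x, z) :: L1); split.
- by move=> s t sL tL; apply/esym/(xP (s.2, s.1) (t.2, t.1)); exact: swapL.
- by move=> s sL; rewrite !inE sL !orbT.
- by exists y; rewrite !inE eqxx orbT.
- by exists x; rewrite inE eqxx.
Qed.

(* Back-and-forth along a countable dense subset. *)
Lemma partial_isometry_extends (L : seq (U * U)) :
  partial_isometry [set` L] -> exists g : isom U, forall s, s \in L -> g s.1 = s.2.
Proof.
case: L => [_|[z0 z1] L0 LP]; first by exists 1%g.
have [D /countable_injP[r rI] Dd] := ury_separable U.
(* The injection [r] into the naturals enumerates [D]; [z0] fills the indices outside its range. *)
pose e n := xget z0 [set x | D x /\ r x = n].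
have eP x : D x -> e (r x) = x.
  move=> Dx; rewrite /e; case: xgetP => [y _ [Dy yx]|/(_ x)[]//].
  by apply: rI => //; exact/mem_set.
pose T := {L : seq (U * U) | partial_isometry [set` L]}.
have nextP (z : U) (K : T) : exists K' : T, [/\ {subset sval K <= sval K'},
    exists y, (z, y) \in sval K' & exists x, (x, z) \in sval K'].
  have [K' [K'P KK' y x]] := partial_isometry_add2 (sval K) z (svalP K).
  by exists (exist _ K' K'P).
pose next z K := projT1 (cid (nextP z K)).
pose Ks := fix Ks n := if n is m.+1 then next (e m) (Ks m)
  else exist (fun L => partial_isometry [set` L]) _ LP.
have KsS n : {subset sval (Ks n) <= sval (Ks n.+1)}.
  by have [] := projT2 (cid (nextP (e n) (Ks n))).
have Ks_le m n : (m <= n)%N -> {subset sval (Ks m) <= sval (Ks n)}.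
  elim: n => [|n IHn]; first by rewrite leqn0 => /eqP ->.
  by rewrite leq_eqVlt => /predU1P[->//|/IHn mn s /mn/KsS].
have dist_dense x eps : 0 < eps -> exists2 n, True & d x (e n) < eps.
  move=> eps0; have [z [+ Dz]] : (ball x eps)^° `&` D !=set0.
    apply: Dd; last exact: open_interior.
    by exists x; apply: nbhs_singleton; apply: nbhs_interior; exact: nbhsx_ballx.
  move=> /interior_subset; rewrite ballEmdist/= => xz.
  by exists (r z) => //; rewrite eP.
have [||| g gP] := @partial_isometry_dense_extends (fun s => exists n, s \in sval (Ks n)).
- move=> s t [m sm] [n tn]; apply: (svalP (Ks (maxn m n))) => /=.
    by apply: Ks_le sm; exact: leq_maxl.
  by apply: Ks_le tn; exact: leq_maxr.
- move=> x eps /(dist_dense x)[n _ xn].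
  have [_ [y ny] _] := projT2 (cid (nextP (e n) (Ks n))).
  by exists (e n, y) => //; exists n.+1.
- move=> x eps /(dist_dense x)[n _ xn].
  have [_ _ [y ny]] := projT2 (cid (nextP (e n) (Ks n))).
  by exists (y, e n) => //; exists n.+1.
- by exists g => s sL; apply: gP; exists 0%N.
Qed.

End CompleteExtension.

(** * Morphisms, double cosets and free amalgamation over a finite subset *)

Section Morphisms.
Context {R : realType} {Lam : set R} {U : urysohn Lam}.
Local Notation d := (@mdist R U).

Lemma isom_mulVK (g : isom U) : cancel g (g^-1)%g.
Proof. by move=> x; rewrite -[LHS]/((g^-1 * g)%g x) mulVg. Qed.

Lemma isom_distV (g : isom U) x y : d (g x) y = d x ((g^-1)%g y).
Proof. by rewrite -(isom_iso (g^-1)%g) isom_mulVK. Qed.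

Lemma mor_of_eqvP (X Y : nefset U) g (p : mor (obj X) (obj Y)) :
  mor_eqv (mor_of X Y g) p <-> forall (x : obj X) (y : obj Y),
    d (g (val x)) (val y) = fdist (mplus p x) (mminus p y).
Proof. exact: mor_eqvP. Qed.

(** The space of [p] embeds in [U] with [Y] kept in place; sending [X] to its image there is a
    finite partial isometry, which extends. *)
Lemma mor_of_surj (X Y : nefset U) (p : mor (obj X) (obj Y)) :
  exists g, mor_eqv (mor_of X Y g) p.
Proof.
have [h hP hY] := @ury_ext _ _ U (obj Y) p (mminus p) val (mminus_iso p)
  (fun _ _ => erefl).
have [|g gP] := partial_isometry_extends
    [seq (val x, h (mplus p x)) | x <- enum (obj X)].
  move=> _ _ /mapP[x _ ->] /mapP[x' _ ->] /=.
  by rewrite hP mplus_iso.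
exists g; apply/mor_of_eqvP => x y.
have /= -> := gP (val x, h (mplus p x)) (map_f _ (mem_enum _ x)).
by rewrite -hP -[val y]hY.
Qed.

(** By the hypothesis, fixing [Y] and sending each [g x] to [g' x] is a partial isometry. An
    extension [k] lies in the stabilizer of [Y], and [(k * g)^-1 * g'] fixes [X]. *)
Lemma dcoset_rel_dist (X Y : nefset U) (g g' : isom U) :
  {in nef X & nef Y, forall x y, d (g x) y = d (g' x) y} ->
  dcoset_rel X Y g g'.
Proof.
move=> gg'.
pose L := [seq (y, y) | y <- enum_fset Y] ++ [seq (g x, g' x) | x <- enum_fset X].
have [|k kP] := partial_isometry_extends L.
  move=> s t /=; rewrite !mem_cat => /orP[]/mapP[x xX ->] /orP[]/mapP[y yY ->] //=.
  - by rewrite udistC gg'// udistC.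
  - exact: gg'.
  - by rewrite !isom_iso.
apply/asboolP; exists k, ((k * g)^-1 * g')%g; split.
- move=> y yY; apply: (kP (y, y)); rewrite mem_cat; apply/orP; left.
  exact: (map_f (fun y => (y, y))).
- move=> x xX; rewrite -[RHS](isom_mulVK (k * g)%g) -[LHS]/(((k * g)^-1)%g (g' x)).
  congr (_ _); apply/esym/(kP (g x, g' x)); rewrite mem_cat; apply/orP; right.
  exact: (map_f (fun x => (g x, g' x))).
- by rewrite mulgA mulgV mul1g.
Qed.

(* The distance of a and b when they are glued freely over Y; the default value
   of the minimum is one of its terms. *)
Definition amalg_dist (Y : nefset U) (a b : U) : R :=
  let D y := Num.max (d a y) (d y b) in
  \big[Num.min/D (val (kpoint (obj Y)))]_(y : obj Y) D (val y).

Lemma amalg_dist_le (Y : nefset U) a b y : y \in nef Y ->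
  amalg_dist Y a b <= Num.max (d a y) (d y b).
Proof.
move=> yY; pose y' : obj Y := FSetSub yY.
exact: (@bigmin_le_cond _ _ _ _ y' xpredT
  (fun y : obj Y => Num.max (d a (val y)) (d (val y) b))).
Qed.

Lemma amalg_dist_ex (Y : nefset U) a b : exists2 y, y \in nef Y &
  amalg_dist Y a b = Num.max (d a y) (d y b).
Proof.
rewrite /amalg_dist.
elim/big_ind: _ => [|u v [y yY ->] [y' yY' ->]|y _].
- by exists (val (kpoint (obj Y))) => //; exact: valP.
- by rewrite /Num.min; case: ifP => _; [exists y|exists y'].
- by exists (val y) => //; exact: valP.
Qed.

Lemma eq_amalg_dist (Y : nefset U) a a' b b' :
  {in nef Y, forall y, d a y = d a' y} -> {in nef Y, forall y, d b y = d b' y} ->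
  amalg_dist Y a b = amalg_dist Y a' b'.
Proof.
move=> aa' bb'; rewrite /amalg_dist.
have E (y : obj Y) : Num.max (d a (val y)) (d (val y) b) =
    Num.max (d a' (val y)) (d (val y) b').
  have yY : val y \in nef Y by exact: valP.
  by rewrite aa'// (udistC _ b) (udistC _ b') bb'.
by rewrite E; apply: eq_bigr => y _; exact: E.
Qed.

Lemma amalg_distC (Y : nefset U) a b : amalg_dist Y a b = amalg_dist Y b a.
Proof.
rewrite /amalg_dist; have E (y : obj Y) : Num.max (d a (val y)) (d (val y) b) =
    Num.max (d b (val y)) (d (val y) a).
  by rewrite maxC udistC [d a _]udistC.
by rewrite E; apply: eq_bigr => y _; exact: E.
Qed.

Lemma amalg_dist_mem (Y : nefset U) a y : y \in nef Y -> amalg_dist Y a y = d a y.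
Proof.
move=> yY; apply/eqP; rewrite eq_le; apply/andP; split.
  by rewrite (le_trans (amalg_dist_le Y _ _ y yY))// mdistxx ge_max lexx mdist_ge0.
by have [y' _ ->] := amalg_dist_ex Y a y; exact: udist_max.
Qed.

(** Moving [Z] by the inverse of [g] puts both morphisms over the same [Y] inside [U], where the
    gluing formula is [amalg_dist]. *)
Lemma cross_dist_amalg (X Y Z : nefset U) (h g : isom U) (x : obj X) (z : obj Z) :
  cross_dist (mplus (mor_of X Y h) x) (mminus (mor_of Y Z g) z) =
  amalg_dist Y (h (val x)) ((g^-1)%g (val z)).
Proof.
rewrite /cross_dist /amalg_dist !mor_ofE (isom_distV g).
by apply: eq_bigr => y _; rewrite !mor_ofE (isom_distV g).
Qed.

(** [s] realises the product of the morphism of [h] with the inclusion of [Y] in its union with [C];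
    free gluing is built into the product. *)
Lemma free_extension (X Y : nefset U) (h : isom U) (C : {fset U}) :
  exists s : isom U,
    {in nef X & nef Y, forall x y, d (s x) y = d (h x) y} /\
    {in nef X & C, forall x c, d (s x) c = amalg_dist Y (h x) c}.
Proof.
have YC0 : (nef Y `|` C)%fset != fset0.
  have /fset0Pn[y yY] := nef_ne Y; apply/fset0Pn; exists y.
  by rewrite in_fsetU yY.
pose Z := NeFset YC0.
have [s /mor_of_eqvP sP] :=
  mor_of_surj X Z (mor_comp (mor_of Y Z 1%g) (mor_of X Y h)).
(* For [c] in [Y] the amalgamated distance is [d (h x) c], so this one formula contains both
   claims. *)
have {}sP : {in nef X & nef Z, forall x c, d (s x) c = amalg_dist Y (h x) c}.
  move=> x c xX cZ; have := sP (FSetSub xX) (FSetSub cZ).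
  by rewrite mor_compE cross_dist_amalg invg1.
exists s; split=> x c xX cY; last by apply: sP => //; rewrite in_fsetU cY orbT.
by rewrite sP ?amalg_dist_mem//= in_fsetU cY.
Qed.

Lemma free_sequence (X Y : nefset U) (h : isom U) (C : {fset U}) :
  exists s : nat -> isom U, [/\
    forall n, {in nef X & nef Y, forall x y, d (s n x) y = d (h x) y},
    forall n, {in nef X & C, forall x c, d (s n x) c = amalg_dist Y (h x) c} &
    forall m n, m != n -> {in nef X &, forall x x',
      d (s m x) (s n x') = amalg_dist Y (h x) (h x')}].
Proof.
pose t D := projT1 (cid (free_extension X Y h D)).
have tP D := projT2 (cid (free_extension X Y h D)).
(* [Cs n] collects [C] and the copies of [X] under all earlier [s m], so that the next copy is free
   from them. *)
pose Cs := fix Cs n : {fset U} :=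
  if n is m.+1 then (Cs m `|` [fset t (Cs m) x | x in nef X])%fset else C.
have Cs_le m n : (m <= n)%N -> {subset Cs m <= Cs n}.
  elim: n => [|n IHn]; first by rewrite leqn0 => /eqP ->.
  rewrite leq_eqVlt => /predU1P[->//|/IHn mn x /mn xn].
  by rewrite in_fsetU xn.
pose s n := t (Cs n).
have sY n : {in nef X & nef Y, forall x y, d (s n x) y = d (h x) y}.
  by have [] := tP (Cs n).
have lt m n : (m < n)%N -> {in nef X &, forall x x',
    d (s n x) (s m x') = amalg_dist Y (h x) (h x')}.
  move=> mn x x' xX xX'; have [_ ->//] := tP (Cs n); last first.
    by apply: (Cs_le _ _ mn); rewrite /= in_fsetU in_imfset ?orbT.
  by apply: eq_amalg_dist => y yY //; exact: sY.
exists s; split=> //.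
- move=> n x c xX cC; have [_ ->//] := tP (Cs n).
  exact: (Cs_le _ _ (leq0n n)).
- move=> m n; rewrite neq_ltn => /orP[mn|nm] x x' xX xX'; last exact: lt.
  by rewrite udistC amalg_distC; exact: lt.
Qed.

(* If e is closer to s m and to s n than the amalgamated distance, the isosceles
   property makes both distances less than the distance from b to Y, which is
   the distance between s m and s n. *)
Lemma free_sequence_eventually (Y : nefset U) (s : nat -> U) (b : U) (e : U) :
  (forall n, {in nef Y, forall y, d (s n) y = d b y}) ->
  (forall m n, m != n -> d (s m) (s n) = amalg_dist Y b b) ->
  exists M, forall n, (M <= n)%N -> d e (s n) = amalg_dist Y e b.
Proof.
move=> sY sfree.
have amE n : amalg_dist Y e (s n) = amalg_dist Y e b.
  by apply: eq_amalg_dist => // y; exact: sY.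
have le n : d e (s n) <= amalg_dist Y e b.
  by rewrite -(amE n); have [y _ ->] := amalg_dist_ex Y e (s n); exact: udist_max.
have near n : d e (s n) != amalg_dist Y e b -> d e (s n) < amalg_dist Y b b.
  move=> neq; have {neq le} : d e (s n) < amalg_dist Y e b by rewrite lt_neqAle neq le.
  have [y yY ->] := amalg_dist_ex Y b b.
  move=> /lt_le_trans/(_ (amalg_dist_le Y _ _ _ yY)).
  rewrite [d y b]udistC maxxx -(sY n)// lt_max => /orP[ey|]; last by rewrite udistC.
  rewrite ltNge; apply/negP => yn.
  have : d e y <= Num.max (d e (s n)) (d (s n) y) by exact: udist_max.
  by rewrite leNgt gt_max ey (le_lt_trans yn ey).
(* Two exceptional indices would contradict [sfree]; hence there is at most one, and [M] is its
   successor. *)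
have [bad|good] := pselect (exists m, d e (s m) != amalg_dist Y e b); last first.
  exists 0%N => n _; apply/eqP; apply: contrapT => /negP bn; by apply: good; exists n.
have [m /near em] := bad; exists m.+1 => n mn; apply/eqP; apply: contrapT => /negP/near en.
have := sfree m n; rewrite neq_ltn mn => /(_ isT) mnE.
have : d (s m) (s n) < amalg_dist Y b b by apply: (@udist_lt _ _ _ e) => //; rewrite udistC.
by rewrite mnE ltxx.
Qed.

End Morphisms.

(** * Weak limits of sequences with constant Gram coefficients *)

Section GramLimit.
Context {R : realType} {H : hilbert R}.
Notation "'[ u , v ]" := (inner H u v).

(** Cauchy-Schwarz for the sum of the first [N] vectors bounds [N * |s|^2] independently of [N]. *)
Lemma orthogonal_const_coef (f : nat -> H) (K s : R[i]) (x : H) :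
  (forall m n, m != n -> '[f m, f n] = 0) -> (forall n, '[f n, f n] = K) ->
  (forall n, '[f n, x] = s) -> s = 0.
Proof.
move=> forth fK fx.
pose F N := \sum_(i < N) f i.
have Fx N : '[F N, x] = N%:R * s.
  rewrite /F linear_sumlz/= (eq_bigr (fun=> s)) ?sumr_const ?card_ord ?mulr_natl//.
have Ff N n : (N <= n)%N -> '[F N, f n] = 0.
  move=> Nn; rewrite /F linear_sumlz/= big1// => i _; apply: forth.
  by rewrite neq_ltn (leq_trans (ltn_ord i) Nn).
have FF N : '[F N, F N] = N%:R * K.
  elim: N => [|N IHN]; first by rewrite /F big_ord0 linear0r mul0r.
  rewrite /F big_ord_recr/= -/(F N) linearDl/= !linearDr/= IHN Ff//.
  by rewrite [X in _ + (X + _)]innerC Ff// conjC0 fK addr0 add0r -natr1 mulrDl mul1r.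
have K0 : 0 <= K by rewrite -(fK 0%N) inner_ge0.
have bnd N : N%:R * `|s| ^+ 2 <= K * '[x, x].
  case: N => [|N]; first by rewrite mul0r mulr_ge0// inner_ge0.
  have N0 : 0 < N.+1%:R :> R[i] by rewrite ltr0n.
  have := cauchy_schwarz (F N.+1) x.
  rewrite -(@ler_sqr R[i]) ?nnegrE ?mulr_ge0 ?normr_ge0//.
  rewrite exprMn !inner_norm Fx FF normrM exprMn normr_nat expr2 -!mulrA.
  by rewrite ler_pM2l.
apply: contrapT => /eqP s0.
have [r r0 rE] := gt0_complex (exprn_gt0 2 (etrans (normr_gt0 s) s0)).
have := ge0_complex (mulr_ge0 K0 (inner_ge0 x)).
set k := complex.Re _ => kE.
have := bnd (Num.bound (k / r)); rewrite rE kE -(rmorph_nat (real_complex R)) -rmorphM/= lecR.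
rewrite -ler_pdivlMr// leNgt archi_boundP// divr_ge0 ?(ltW r0)//.
by rewrite -lecR -kE mulr_ge0// inner_ge0.
Qed.

Section VanishingCoefficients.
Context (e : nat -> H) (B : R[i]) (eB : forall n, `|e n| <= B).

Definition vanishing_set : set H := [set x |
  forall eps, 0 < eps -> exists M, forall n, (M <= n)%N -> `|'[e n, x]| <= eps].

Lemma vanishing_set0 : vanishing_set 0.
Proof.
by move=> eps eps0; exists 0%N => n _; rewrite linear0r normr0 ltW.
Qed.

Lemma vanishing_set_lin (a : R[i]) u v :
  vanishing_set u -> vanishing_set v -> vanishing_set (a *: u + v).
Proof.
move=> Su Sv eps eps0.
have a0 : 0 < `|a| + 1 by rewrite ltr_wpDl.
have [M Mu] := Su (eps / 2 / (`|a| + 1)) (divr_gt0 (divr_gt0 eps0 (ltr0n _ 2)) a0).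
have [M' Mv] := Sv (eps / 2) (divr_gt0 eps0 (ltr0n _ 2)).
exists (maxn M M') => n; rewrite geq_max => /andP[/Mu nu /Mv nv].
rewrite linearDr/= linearZr_LR/= (le_trans (ler_normD _ _))//.
rewrite [leRHS]splitr lerD// normrM norm_conjC.
rewrite ler_pdivlMr// in nu; rewrite (le_trans _ nu)// mulrC ler_wpM2l//.
by rewrite lerDl.
Qed.

(** The uniform bound [B] makes a small change of [x] a small change of all coefficients at once. *)
Lemma vanishing_set_closed : closed vanishing_set.
Proof.
move=> x xS eps eps0.
(* Adding 1 keeps the divisor positive when [B] is 0. *)
have B0 : 0 < B + 1 by rewrite ltr_wpDl// (le_trans _ (eB 0)).
have [y [yS]] := xS _ (nbhsx_ballx x _
  (divr_gt0 (divr_gt0 eps0 (ltr0n _ 2)) B0)).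
rewrite -ball_normE/= => /ltW xy.
have [M My] := yS _ (divr_gt0 eps0 (ltr0n _ 2)).
exists M => n /My ny; rewrite -[x](subrK y) linearDr/=.
rewrite (le_trans (ler_normD _ _))// [leRHS]splitr lerD//.
rewrite (le_trans (cauchy_schwarz _ _))//.
rewrite ler_pdivlMr// in xy; rewrite (le_trans _ xy)// mulrC ler_wpM2l//.
by rewrite (le_trans (eB n))// lerDl.
Qed.

Definition vanishing : closed_subspace H :=
  ClosedSubspace vanishing_set0 vanishing_set_lin vanishing_set_closed.

End VanishingCoefficients.

(* e 0 splits into a vector p with '[e n, p] -> 0 and a vector u orthogonal to
   all such vectors. The differences e n - e 0 have vanishing coefficients, so
   '[e n, u] does not depend on n and the e n - u are pairwise orthogonal. *)
Lemma gram_limit (e : nat -> H) (c K : R[i]) :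
  (forall m n, m != n -> '[e m, e n] = c) -> (forall n, '[e n, e n] = K) ->
  exists u, forall x t M, (forall n, (M <= n)%N -> '[e n, x] = t) -> '[u, x] = t.
Proof.
move=> ec eK.
have eB n : `|e n| <= `|e 0%N| by rewrite !norm_inner !eK.
pose S := vanishing e _ eB.
pose p := val (Defs.proj S (e 0%N)); pose u := e 0%N - p.
have uS x : vanishing_set e x -> '[u, x] = 0.
  by move=> Sx; have /cs_predP Sx' : cs_set S x by []; exact: (proj_orth _ (Subsp Sx')).
have pS : vanishing_set e p by exact: (@subspP _ _ S).
have ue0 n : '[u, e n] = '[u, e 0%N].
  apply/eqP; rewrite -subr_eq0 -linearBr/=; apply/eqP/uS => eps eps0.
  (* From here on [m] differs from both [n] and 0, so both Gram coefficients equal [c]. *)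
  exists (maxn n.+1 1) => m; rewrite geq_max => /andP[nm m0].
  rewrite linearBr/= !ec ?subrr ?normr0 ?ltW//; first by rewrite neq_ltn m0 orbT.
  by rewrite neq_ltn nm orbT.
have uu : '[u, u] = '[u, e 0%N].
  by rewrite {2}/u linearBr/= (uS _ pS) subr0.
have eu n : '[e n, u] = '[u, u] by rewrite innerC ue0 -uu -innerC.
(* For [m] at least 1, ['[e m, u]] is [c - '[e m, p]]; it is also the constant ['[u, u]], and
   ['[e m, p]] tends to 0. *)
have uc : '[u, u] = c.
  apply/eqP; rewrite -subr_eq0 -normr_le0; apply/ler_addgt0Pl => eps eps0.
  have [M Mp] := pS _ eps0; rewrite addr0.
  rewrite -(eu (maxn M 1)) /u linearBr/= ec; last first.
    by rewrite neq_ltn (leq_trans _ (leq_maxr M 1)) ?orbT.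
  by rewrite addrAC subrr add0r normrN Mp ?leq_maxl.
(* The vectors [e (M + n) - u] are orthogonal, of squared norm [K - c], with constant coefficient [t
   - '[u, x]]. *)
clearbody u; exists u => x t M ext; apply/eqP; rewrite eq_sym -subr_eq0; apply/eqP.
apply: (@orthogonal_const_coef (fun n => e (M + n)%N - u) (K - c) _ x).
- move=> m n mn; rewrite linearBl/= !linearBr/= eu ue0 -uu uc ec ?subrr//.
  by rewrite eqn_add2l.
- by move=> n; rewrite linearBl/= !linearBr/= eu ue0 -uu uc eK subrr subr0.
- by move=> n; rewrite linearBl/= ext ?leq_addr.
Qed.

End GramLimit.

(** * Multiplicativity of the compressed operators *)

Section Compression.
Context {R : realType} {Lam : set R} {U : urysohn Lam} {H : hilbert R}.
Context (rho : unirep U H).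
Local Notation d := (@mdist R U).
Local Notation "'[ u , v ]" := (inner H u v).
Local Notation "H[ X ]" := (subhilb (fixed rho X)).

Lemma hilbert_ext (K : hilbert R) (u v : K) :
  (forall w, inner K u w = inner K v w) -> u = v.
Proof.
move=> uv; apply/eqP; rewrite -subr_eq0; apply/eqP/inner_eq0.
by rewrite linearBl/= uv subrr.
Qed.

Lemma rep1 v : rho 1%g v = v.
Proof.
apply: (bij_inj (unitary_bij (rho 1%g))).
by rewrite -[LHS]/((rho 1%g * rho 1%g)%g v) -rep_morph mulg1.
Qed.

Lemma repM g h v : rho (g * h)%g v = rho g (rho h v).
Proof. by rewrite rep_morph. Qed.

Lemma inner_repV g u v : '[rho g u, v] = '[u, rho (g^-1)%g v].
Proof. by rewrite -(unitary_inner (rho (g^-1)%g)) -repM mulVg rep1. Qed.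

Lemma inner_compress (X Y : nefset U) g (v : H[X]) (w : H[Y]) :
  inner H[Y] (compress rho X Y g v) w = '[rho g (val v), val w].
Proof.
apply/esym/eqP; rewrite -subr_eq0 -[X in _ - X]/('[val (compress rho X Y g v), val w]).
by rewrite -linearBl/= proj_orth.
Qed.

(** By unitarity this is a coefficient of the compression of [b^-1 * a], whose double coset is
    determined by the distances [d (a x) (b y)]. *)
Lemma inner_rep_dist (X Y : nefset U) (a b a' b' : isom U) (v : H[X]) (w : H[Y]) :
  {in nef X & nef Y, forall x y, d (a x) (b y) = d (a' x) (b' y)} ->
  '[rho a (val v), rho b (val w)] = '[rho a' (val v), rho b' (val w)].
Proof.
move=> ab; rewrite -[LHS](unitary_inner (rho (b^-1)%g)).
rewrite -[RHS](unitary_inner (rho (b'^-1)%g)) -!repM !mulVg !rep1.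
rewrite -!(inner_compress X Y); congr (inner H[Y] _ w).
apply: compress_dcoset; apply: dcoset_rel_dist => x y xX yY.
have E (f g : isom U) : d ((g^-1 * f)%g x) y = d (f x) (g y).
  by rewrite -[LHS]/(d ((g^-1)%g (f x)) y) isom_distV invgK.
by rewrite !E ab.
Qed.

(** The choice made in [rhohat] is immaterial: isometries with the same morphism share a double
    coset. *)
Lemma rhohat_mor_of (X Y : nefset U) g (p : mor (obj X) (obj Y)) :
  mor_eqv (mor_of X Y g) p -> rhohat rho p =1 compress rho X Y g.
Proof.
move=> gp v; rewrite /rhohat.
pose A := [set g | mor_eqv (mor_of X Y g) p].
have /mor_of_eqvP pE : A (xget 1%g A).
  by apply: xgetPex; exists g.
apply: compress_dcoset; apply: dcoset_rel_dist => x y xX yY.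
have /mor_of_eqvP gE := gp.
by have := pE (FSetSub xX) (FSetSub yY); rewrite -gE.
Qed.

(* The vectors e n = rho (s n) v for a free sequence s have constant Gram
   coefficients; their weak limit is the projection of rho h v to H[Y]. *)
Lemma compress_comp (X Y Z : nefset U) (h g r : isom U) (v : H[X]) :
  {in nef X & nef Z, forall x z,
    d (r x) z = amalg_dist Y (h x) ((g^-1)%g z)} ->
  compress rho Y Z g (compress rho X Y h v) = compress rho X Z r v.
Proof.
move=> rP; apply: hilbert_ext => w; rewrite !inner_compress inner_repV.
have [s [sY sZ sfree]] := free_sequence X Y h [fset (g^-1)%g z | z in nef Z]%fset.
pose e n := rho (s n) (val v).
have eE m n : m != n -> '[e m, e n] = '[e 0%N, e 1%N].
  move=> mn; apply: inner_rep_dist => x x' xX xX'.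
  by rewrite !sfree.
have ee n : '[e n, e n] = '[val v, val v] by rewrite unitary_inner.
have [u uP] := gram_limit e _ _ eE ee.
have far k n : stab Y k -> exists M, forall m, (M <= m)%N ->
    '[e m, rho k (e n)] = '[e 0%N, e 1%N].
  move=> kY.
  (* Each pair of points of [X] has its own threshold; there are finitely many pairs, so the maximum
     serves all. *)
  have /choice[M MP] (t : obj X * obj X) : exists M, forall m, (M <= m)%N ->
      d (k (s n (val t.2))) (s m (val t.1)) = amalg_dist Y (h (val t.1)) (h (val t.2)).
    have tX : val t.1 \in nef X by exact: valP.
    have tX' : val t.2 \in nef X by exact: valP.
    have [||M MP] := free_sequence_eventually Y (fun m => s m (val t.1))
      (h (val t.1)) (k (s n (val t.2))).
    - by move=> m y yY; exact: sY.
    - by move=> m m' mm'; exact: sfree.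
    exists M => m /MP ->; rewrite amalg_distC; apply: eq_amalg_dist => y yY //.
    by rewrite -[in LHS](kY _ yY) isom_iso; exact: sY.
  exists (\max_t M t) => m Mm; rewrite -repM.
  apply: inner_rep_dist => x x' xX xX'; rewrite sfree//.
  pose t : obj X * obj X := (FSetSub xX, FSetSub xX').
  by rewrite udistC -(MP t m) // (leq_trans _ Mm)// leq_bigmax.
(* Using the weak limit in each argument gives a value independent of [k]; taking [k = 1] identifies
   it. *)
have uk k : stab Y k -> '[u, rho k u] = '[u, u].
  have uk' k' : stab Y k' -> '[u, rho (k'^-1)%g u] = ('[e 0%N, e 1%N])^*.
    move=> kY; apply: (uP _ _ 0%N) => n _; rewrite innerC inner_repV invgK.
    by have [M /uP ->] := far k' n kY.
  move=> kY; rewrite -[k]invgK uk'; last exact: stabV.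
  by rewrite -(uk' 1%g) ?invg1 ?rep1//; exact: stab1.
(* Expanding the squared norm of [rho k u - u] gives 0. *)
have uY : fixed_set rho Y u.
  move=> k /uk kE; apply/eqP; rewrite -subr_eq0; apply/eqP/inner_eq0.
  have kuE : '[rho k u, u] = '[u, u] by rewrite innerC kE -innerC.
  by rewrite linearBl/= !linearBr/= unitary_inner kE kuE subrr.
have /cs_predP uS : cs_set (fixed rho Y) u by [].
(* Against [H[Y]] every [e n] has the coefficients of [rho h v], since [s n] and [h] give the same
   distances to [Y]. *)
have -> : compress rho X Y h v = Subsp uS.
  apply: proj_uniq => z; rewrite linearBl/= (uP _ '[rho h (val v), val z] 0%N) ?subrr//.
  move=> n _; rewrite -[X in '[_, X]]rep1 -[X in _ = '[_, X]]rep1.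
  by apply: inner_rep_dist => x y xX yY; exact: sY.
apply: (uP _ _ 0%N) => n _; rewrite -[X in _ = '[_, X]]rep1.
apply: inner_rep_dist => x z xX zZ; rewrite rP// sZ//.
by rewrite in_imfset.
Qed.

End Compression.

(** * Continuity for the weak operator topology *)

Section Continuity.
Context {R : realType} {Lam : set R} {U : urysohn Lam} {H : hilbert R}.
Context (rho : unirep U H).

Lemma rep_coef_continuous (v w : H) :
  continuous (fun g : isom U => inner H (rho g v) w : R[i]^o).
Proof.
move=> g; have FF : Filter (nbhs g) by exact: nbhs_filter.
apply/cvgrPdist_le => eps eps0.
have rho_cvg : (fun g' : isom U => rho g' v) @ g --> rho g v.
  apply: (@continuous_comp _ _ _ rho (fun f => proj v (unitary_ptws f))).
    exact: rep_cont.
  apply: (@continuous_comp _ _ _ (@unitary_ptws R H) (proj v)).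
    exact: initial_continuous.
  exact: proj_continuous.
have w0 : 0 < `|w| + 1 by rewrite ltr_wpDl.
move/cvgrPdist_le : rho_cvg => /(_ (eps / (`|w| + 1)) (divr_gt0 eps0 w0)).
apply: filterS => g'; rewrite ler_pdivlMr// => gg'.
rewrite -linearBl/= (le_trans (cauchy_schwarz _ _))// (le_trans _ gg')//.
by rewrite ler_wpM2l// lerDl.
Qed.

Lemma rhohat_dcoset (X Y : nefset U) (g : isom U) :
  rhohat rho (dcoset_mor (\pi_(dcoset X Y)%qT g)) =1 compress rho X Y g.
Proof.
move=> v; rewrite (rhohat_mor_of _ _ _ _ _ (mor_eqv_refl _)).
apply: compress_dcoset; rewrite -[dcoset_rel _ _]/(dcoset_equiv X Y : rel _).
by apply/eqmodP; rewrite reprK.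
Qed.

(** The quotient topology on the source and the initial topology on the target reduce this to the
    continuity of single matrix coefficients on the group. *)
Lemma rhohat_continuous (X Y : nefset U) :
  continuous ((fun c => rhohat rho (dcoset_mor c)) :
    dcoset X Y -> wot (subhilb (fixed rho X)) (subhilb (fixed rho Y))).
Proof.
apply: continuous_comp_initial; apply/quotient_continuous => g.
have FF : Filter (nbhs g) by exact: nbhs_filter.
pose coef (g' : isom U) := matrix_coef (rhohat rho (dcoset_mor (\pi_(dcoset X Y)%qT g'))).
suff : {ptws, coef @ g --> coef g} by [].
apply/pointwise_cvgP => -[v w].
have coefE : (coef^~ (v, w)) = (fun g' => inner H (rho g' (val v)) (val w)).
  apply/funext => g'; rewrite -inner_compress -rhohat_dcoset.
  by [].
have coef_cvg : continuous_at g (coef^~ (v, w) : isom U -> R[i]^o).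
  by rewrite coefE; exact: rep_coef_continuous.
exact: coef_cvg.
Qed.

End Continuity.

(** * The five properties, through isometries realising the morphisms *)

Theorem theorem1p3 (R : realType) (Lam : set R)
    (Lam_gt0 : forall l, Lam l -> 0 < l) (Lam_countable : countable Lam)
    (U : urysohn Lam) (H : hilbert R) (H_separable : separable H)
    (rho : unirep U H) :
  [/\ forall (X Y Z : nefset U)
        (p : mor (obj X) (obj Y)) (q : mor (obj Y) (obj Z))
        (v : subhilb (fixed rho X)),
        rhohat rho q (rhohat rho p v) = rhohat rho (mor_comp q p) v,
      forall (X Y : nefset U) (p : mor (obj X) (obj Y)),
        opnorm (rhohat rho p) <= 1,
      forall (X Y : nefset U) (p : mor (obj X) (obj Y)),
        is_adjoint (rhohat rho p) (rhohat rho (mor_inv p)),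
      forall X Y : nefset U,
        continuous ((fun c => rhohat rho (dcoset_mor c)) :
          dcoset X Y -> wot (subhilb (fixed rho X)) (subhilb (fixed rho Y))) &
      forall (X : nefset U) (v : subhilb (fixed rho X)),
        rhohat rho (mor_id (obj X)) v = v].
Proof.
split.
- move=> X Y Z p q v.
  have [h hp] := mor_of_surj X Y p; have [g gq] := mor_of_surj Y Z q.
  have [r rqp] := mor_of_surj X Z (mor_comp q p).
  rewrite (rhohat_mor_of _ _ _ _ _ hp) (rhohat_mor_of _ _ _ _ _ gq).
  rewrite (rhohat_mor_of _ _ _ _ _ rqp); apply: compress_comp => x z xX zZ.
  pose x' : obj X := FSetSub xX; pose z' : obj Z := FSetSub zZ.
  rewrite -(cross_dist_amalg X Y Z h g x' z') -mor_compE.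
  (* The product respects equality of morphisms, so it may be computed from [h] and [g]. *)
  have /mor_eqvP <- := mor_comp_eqv (mor_eqv_sym hp) (mor_eqv_sym gq).
  by move/mor_of_eqvP : rqp => /(_ x' z').
- move=> X Y p; apply: ge_sup.
    by exists (complex.Re `|rhohat rho p 0|), 0 => //=; rewrite normr0.
  move=> _ [v v1 <-]; rewrite -lecR.
  rewrite -(ge0_complex (normr_ge0 _)) (le_trans _ v1)//.
  exact: compress_norm.
- move=> X Y p v w; have [g gp] := mor_of_surj X Y p.
  (* The inverse of [g] realises the involution, and by unitarity it acts as the adjoint. *)
  have gp' : mor_eqv (mor_of Y X (g^-1)%g) (mor_inv p).
    apply/mor_of_eqvP => y x; rewrite isom_distV invgK udistC.
    have := mor_of_eqvP X Y g p; move=> [/(_ gp) -> _].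
    by have [_ -> _] := @fu_ultra _ _ p.
  rewrite (rhohat_mor_of _ _ _ _ _ gp) (rhohat_mor_of _ _ _ _ _ gp').
  by rewrite inner_compress inner_repV innerC -inner_compress -innerC.
- exact: rhohat_continuous.
- move=> X v; have id1 : mor_eqv (mor_of X X 1%g) (mor_id (obj X)).
    exact/mor_of_eqvP.
  rewrite (rhohat_mor_of _ _ _ _ _ id1); apply: hilbert_ext => w.
  by rewrite inner_compress rep1.
Qed.
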